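(* Suppose that the fixed points $\alpha\le\beta$ of $\varphi$ are real and that $\alpha\ge 1$. Then the martingale $(Z_n)_{n\ge1}$ is bounded in $L^2$ and converges to a limit $Z$ such that $\mathbb E(Z^2)=\alpha$. Hence the probability distribution $\mathsf M$ of $Z$ is a fixed point of $\mathsf S_2$ and of $\mathsf T$, and $\int |x|^2\,\mathsf M(\mathrm dx)=\alpha$.
   Context: Let $a=(a_j)_{j\ge 1}$ be a sequence of non-negative random variables with $\mathbb E\sum_{j\ge1}a_j=1$ and $\mathbb E\big(\sum_{j\ge1}a_j\big)^2<\infty$; it is excluded that almost surely $a_j\in\{0,1\}$ for all $j\ge1$. Set $b=\frac{\mathbb E(\sum a_j)^2}{\mathbb E\sum a_j^2}$ and $q=\frac1{\mathbb E(\sum a_j)^2}$, and suppose $b>2$. Let $\varphi(x)=\frac{b-1}{bq-x}$; its fixed points are the roots of $x^2-bqx+b-1$, denoted $\alpha\le\beta$ when they are real. Words: $\mathbb N_+$ is the set of positive integers, $\mathscr T_n=\mathbb N_+^n$, $\mathscr T=\bigcup_{n\ge0}\mathscr T_n$, $\epsilon$ is the empty word (on any alphabet), juxtaposition is concatenation, $w|_k$ is the prefix of length $k$ of $w$. The map $\mathsf T$: let $\mu$ be the law of a complex random variable $W$ with $\mathbb EW=1$ and $\mathbb E|W|^2<bq$. Let $(W(w))_{w\in\mathscr T}$ and $(a(w))_{w\in\mathscr T}$ be two independent families of independent copies of $W$ and of $a$ respectively. Then $Y_n=\sum_{w=j_1\cdots j_n\in\mathscr T_n}\prod_{k=0}^{n-1}a_{j_{k+1}}(w|_k)\,W(w|_{k+1})$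 is a martingale bounded in $L^2$; $\mathsf T\mu$ is the law of its limit $Y$. The map $\mathsf S_2$: for a probability measure $\mu$ on $\mathbb C$, $\mathsf S_2(\mu)$ is the law of $\sum_{j\ge1}a_jW(j)\widetilde W(j)$, where the $W(j),\widetilde W(j)$, $j\ge1$, are independent, of law $\mu$, and independent of $a$. The martingale $(Z_n)$: let $\{a(w,m)\}$, indexed by $(w,m)\in\bigcup_{n\ge0}\mathscr T_n\times\{0,1\}^n$, be independent copies of $a$. Put $Z_1(w,m)=\sum_{j\ge1}a_j(w,m)$ and, for $n\ge2$, $Z_n(w,m)=\sum_{j\ge1}a_j(w,m)\,Z_{n-1}(wj,m0)\,Z_{n-1}(wj,m1)$. Set $Z_n=Z_n(\epsilon,\epsilon)$. It is a non-negative martingale with respect to $\mathcal G_n=\sigma\big(a(w,m):(w,m)\in\bigcup_{k=0}^{n-1}\mathscr T_k\times\{0,1\}^k\big)$. *)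

(* Defs.v *)
From HB Require Import structures.
From mathcomp Require Import all_boot all_order all_algebra finmap.
From mathcomp Require Import all_classical all_reals all_analysis measurable_realfun.
From mathcomp Require Export complex.
Set Implicit Arguments.
Unset Strict Implicit.
Unset Printing Implicit Defensive.
Import Order.TTheory GRing.Theory Num.Theory.
Import numFieldNormedType.Exports.
Local Open Scope classical_set_scope.
Local Open Scope ring_scope.
Local Open Scope complex_scope.

HB.instance Definition _ (R : realType) :=
  PseudoPointedMetric.copy R[i] (R[i])^o.

(* The Borel sigma-algebra of the complex plane, generated by the real and
   imaginary parts. *)
Definition complex_borel_gen (R : realType) : set_system R[i] :=
  preimage_set_system setT (@complex.Re R) measurable `|`
  preimage_set_system setT (@complex.Im R) measurable.

HB.instance Definition _ (R : realType) :=
  @isMeasurable.Build (sigma_display (@complex_borel_gen R)) R[i]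
    <<s @complex_borel_gen R >>
    (@sigma_algebra0 _ setT _) (@sigma_algebraC _ _)
    (@sigma_algebra_bigcup _ setT _).

Lemma measurable_real_complex (R : realType) :
  measurable_fun [set: R] (real_complex R).
Proof.
apply: (@measurability _ _ _ _ _ _ (@complex_borel_gen R)) => //.
move=> _ [_ [|] [A mA <-] <-]; rewrite !setTI -comp_preimage.
- exact: mA.
- rewrite (_ : _ \o _ = cst 0); last exact/funext.
  by have := @measurable_cst _ _ R R setT 0 measurableT A mA; rewrite setTI.
Qed.

HB.instance Definition _ (R : realType) :=
  isMeasurableFun.Build _ _ R R[i] (real_complex R)
    (@measurable_real_complex R).

(* [Rseq R] is [nat -> R] with the product sigma-algebra: a sequence of real
   random variables on [(Om, P)] is an [a : {RV P >-> Rseq R}], and its joint law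
   is [distribution P a].  Throughout, the positive integer [j] is encoded by the
   natural number [j - 1], so that [a x 0] is the first term of the sequence. *)
Definition cylinders (R : realType) : set_system (nat -> R) :=
  \bigcup_j preimage_set_system setT (fun s : nat -> R => s j) measurable.

Definition Rseq (R : realType) := g_sigma_algebraType (@cylinders R).
HB.instance Definition _ (R : realType) := Measurable.on (Rseq R).

Section independence.
Context {d : measure_display} {Om : measurableType d} {R : realType}.
Variable P : probability Om R.

Definition independent_systems (F G : set_system Om) : Prop :=
  forall A B, F A -> G B -> P (A `&` B) = (P A * P B)%E.

Context {I : choiceType} {d' : measure_display} {E : measurableType d'}.
Variables (D : set I) (X : I -> {RV P >-> E}).

Definition independent_family : Prop :=
  forall (J : {fset I}) (B : I -> set E), [set` J] `<=` D ->
    (forall i, i \in J -> measurable (B i)) ->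
    P (\bigcap_(i in [set` J]) (X i @^-1` B i)) =
    (\prod_(i <- J) P (X i @^-1` B i))%E.

Definition family_sigma_algebra : set_system Om :=
  <<s \bigcup_(i in D) g_sigma_algebra_preimage (X i) >>.

End independence.

Definition has_law (d d' : measure_display) (Om : measurableType d)
    (E : measurableType d') (R : realType) (P : probability Om R)
    (X : {RV P >-> E}) (L : set E -> \bar R) : Prop :=
  forall B, measurable B -> distribution P X B = L B.

Definition iid_family (d d' : measure_display) (Om : measurableType d)
    (E : measurableType d') (R : realType) (P : probability Om R)
    (I : choiceType) (D : set I) (X : I -> {RV P >-> E})
    (L : set E -> \bar R) : Prop :=
  independent_family D X /\ (forall i, D i -> has_law (X i) L).

(* The integral identity over the events of [G n] says that [X n] is a version of
   the conditional expectation of [X n.+1] given [G n]. *)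
Definition martingale (d : measure_display) (Om : measurableType d)
    (R : realType) (P : probability Om R) (G : nat -> set_system Om)
    (X : nat -> Om -> \bar R) : Prop :=
  [/\ forall n, sigma_algebra setT (G n) /\ G n `<=` measurable,
      forall n, G n `<=` G n.+1,
      forall n, g_sigma_algebra_preimage (X n) `<=` G n,
      forall n, P.-integrable setT (X n) &
      forall n A, G n A ->
        (\int[P]_(x in A) X n.+1 x = \int[P]_(x in A) X n x)%E].

Section parameters.
Context {d : measure_display} {Om : measurableType d} {R : realType}.
Variables (P : probability Om R) (a : {RV P >-> Rseq R}).

Definition sum_seq (s : Rseq R) : \bar R := (\sum_(0 <= j <oo) (s j)%:E)%E.
Definition sum_sq (s : Rseq R) : \bar R :=
  (\sum_(0 <= j <oo) (s j ^+ 2)%:E)%E.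

Definition bpar : R :=
  fine (\int[P]_x (sum_seq (a x) ^+ 2))%E / fine (\int[P]_x sum_sq (a x))%E.
Definition qpar : R := (fine (\int[P]_x (sum_seq (a x) ^+ 2))%E)^-1.

(* The convention [y / 0 = 0] creates no fixed point at the pole [x = b * q],
   since [0 < b * q]. *)
Definition phi (x : R) : R := (bpar - 1) / (bpar * qpar - x).

End parameters.

(* [F] sums to [l] along the finite subsets of [D] ordered by inclusion: the
   order-free sum of a countable family indexed by [D]. *)
Definition sums_to (R : realType) (I : choiceType) (D : set I) (F : I -> R[i])
    (l : R[i]) : Prop :=
  (fun J : {fset I} => \sum_(i <- J | `[< D i >]) F i) @
    filter_from setT (fun A : {fset I} => [set B | (A `<=` B)%fset]) --> l.

Section transformations.
Context {d0 : measure_display} {Om0 : measurableType d0} {R : realType}.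
Variables (P0 : probability Om0 R) (a0 : {RV P0 >-> Rseq R}).

(* [T_family mu a W]: [W] and [a] are two independent families, indexed by all
   words, of independent copies of law [mu] and of [a0] respectively. *)
Definition T_family (mu : probability R[i] R) (d : measure_display)
    (Om : measurableType d) (P : probability Om R)
    (a : seq nat -> {RV P >-> Rseq R}) (W : seq nat -> {RV P >-> R[i]}) : Prop :=
  [/\ iid_family setT W mu,
      iid_family setT a (distribution P0 a0) &
      independent_systems P (family_sigma_algebra setT W)
        (family_sigma_algebra setT a)].

(* The letter [j_(k+1)] of [w] is [nth 0 w k] and the prefix of length [k] is
   [take k w]. *)
Definition T_term (Om : Type) (a : seq nat -> Om -> nat -> R)
    (W : seq nat -> Om -> R[i]) (n : nat) (x : Om) (w : seq nat) : R[i] :=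
  \prod_(k < n) ((a (take k w) x (nth 0%N w k))%:C * W (take k.+1 w) x).

Definition T_limit_law (d : measure_display) (Om : measurableType d)
    (P : probability Om R) (a : seq nat -> {RV P >-> Rseq R})
    (W : seq nat -> {RV P >-> R[i]}) (nu : probability R[i] R) : Prop :=
  exists (Yn : nat -> Om -> R[i]) (Y : {RV P >-> R[i]}),
    [/\ {ae P, forall x, forall n,
           sums_to [set w : seq nat | size w = n] (T_term a W n x) (Yn n x)},
        {ae P, forall x, Yn n x @[n --> \oo] --> Y x} &
        has_law Y nu].

(* The graph of the map T: [mu] lies in its domain, a family as above exists on
   some probability space, and on every such space the limit has law [nu]. *)
Definition T_maps (mu nu : probability R[i] R) : Prop :=
  [/\ (\int[mu]_z (complex.Re z)%:E = 1)%E,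
      (\int[mu]_z (complex.Im z)%:E = 0)%E,
      (\int[mu]_z ((Normc.normc z) ^+ 2)%:E < (bpar a0 * qpar a0)%:E)%E,
      exists (d : measure_display) (Om : measurableType d)
        (P : probability Om R) (a : seq nat -> {RV P >-> Rseq R})
        (W : seq nat -> {RV P >-> R[i]}), T_family mu a W &
      forall (d : measure_display) (Om : measurableType d)
        (P : probability Om R) (a : seq nat -> {RV P >-> Rseq R})
        (W : seq nat -> {RV P >-> R[i]}),
        T_family mu a W -> T_limit_law a W nu].

(* [W (j, false)] and [W (j, true)] are the two independent copies attached to
   [j]. *)
Definition S2_family (mu : probability R[i] R) (d : measure_display)
    (Om : measurableType d) (P : probability Om R)
    (a : {RV P >-> Rseq R}) (W : (nat * bool)%type -> {RV P >-> R[i]}) : Prop :=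
  [/\ iid_family setT W mu,
      has_law a (distribution P0 a0) &
      independent_systems P (family_sigma_algebra setT W)
        (g_sigma_algebra_preimage a)].

Definition S2_sum_law (d : measure_display) (Om : measurableType d)
    (P : probability Om R) (a : {RV P >-> Rseq R})
    (W : (nat * bool)%type -> {RV P >-> R[i]}) (nu : probability R[i] R) : Prop :=
  exists2 Y : {RV P >-> R[i]},
    {ae P, forall x,
       \sum_(0 <= j < n) (a x j)%:C * W (j, false) x * W (j, true) x
         @[n --> \oo] --> Y x} &
    has_law Y nu.

Definition S2_maps (mu nu : probability R[i] R) : Prop :=
  (exists (d : measure_display) (Om : measurableType d)
     (P : probability Om R) (a : {RV P >-> Rseq R})
     (W : (nat * bool)%type -> {RV P >-> R[i]}), S2_family mu a W) /\
  (forall (d : measure_display) (Om : measurableType d)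
     (P : probability Om R) (a : {RV P >-> Rseq R})
     (W : (nat * bool)%type -> {RV P >-> R[i]}),
     S2_family mu a W -> S2_sum_law a W nu).

End transformations.

(* Index set of the family [a(w, m)]: pairs of words of equal length. *)
Definition same_length : set (seq nat * seq bool) :=
  [set wm | size wm.1 = size wm.2].

Section Zmartingale.
Context {d : measure_display} {Om : measurableType d} {R : realType}.
Variables (P : probability Om R) (a : seq nat * seq bool -> {RV P >-> Rseq R}).

(* The value [1] at rank [0] makes the rank [1] equal to the sum of the
   [a_j(w, m)].  Values are extended reals because the sums may diverge on a
   negligible event. *)
Fixpoint Zrec (n : nat) (w : seq nat) (m : seq bool) (x : Om) : \bar R :=
  if n is k.+1 then
    (\sum_(0 <= j <oo) ((a (w, m) x j)%:E
       * Zrec k (rcons w j) (rcons m false) x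
       * Zrec k (rcons w j) (rcons m true) x))%E
  else 1%E.

Definition Zn (n : nat) : Om -> \bar R := Zrec n [::] [::].

Definition Gn (n : nat) : set_system Om :=
  family_sigma_algebra (same_length `&` [set wm | (size wm.1 < n)%N]) a.

End Zmartingale.

(* Main.v *)
Require Import Defs.
From HB Require Import structures.
From mathcomp Require Import all_boot all_order all_algebra finmap.
From mathcomp Require Import ring lra.
From mathcomp Require Import all_classical all_reals all_analysis measurable_realfun.
Import Order.TTheory GRing.Theory Num.Theory.
Import numFieldNormedType.Exports.
Local Open Scope classical_set_scope.
Local Open Scope ring_scope.

(** Split the second moment of the total weight as
    E (sum_j a_j)^2 = s + o, with s = sum_j E a_j^2 and o the sum of the
    E (a_i a_j) over i <> j.  Then b q = 1 / s, and the fixed points of phi are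
    the roots of s x^2 + o = x.  Their sum is 1 / s and alpha is the smaller
    one, so 2 s alpha <= 1.

    In the square of sum_j a_j Z_n(j0) Z_n(j1), independence turns an
    off-diagonal term into E (a_i a_j), because every Z_n has mean 1, and a
    diagonal term into E (a_j^2) (E Z_n^2)^2.  Hence
    E Z_(n+1)^2 = s (E Z_n^2)^2 + o (branching_second_moment).  Started from 1,
    which is at most alpha, this recursion increases to alpha
    (second_moment_cvg), so the martingale is bounded in L^2.  If
    alpha = beta the increments of E Z_n^2 decay like n^(-2) only, too slowly to
    sum the L^2 norms of the increments of Z_n; almost sure convergence
    therefore rests on a maximal inequality of Kolmogorov type
    (maximal_inequality, orth_ae_cvg), and orth_limit identifies the moments of
    the limit.

    The same second moment formula bounds the L^2 distance between Z_(n+1) and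
    sum_j a_j Z(j0) Z(j1), which gives Z = sum_j a_j Z(j0) Z(j1) almost surely
    (Zlim_fixed_point); this is the statement about S_2.  For T, iterate this
    identity in the factors Z(j0) only.  Replacing the innermost factor by its
    mean 1 produces variables Y_n with Y_0 = 1 and
    Y_(n+1) = sum_j a_j Y_n(j0) Z(j1), and
    E (Z - Y_n)^2 = (alpha - 1) (s alpha)^n.  As s alpha <= 1/2 this is
    summable, whence Y_n tends to Z almost surely (Yr_cvg).  The factors Z(j1)
    met along the way are independent copies of Z, independent of the weights on
    the words whose second component is constant, so Y_n is the martingale that
    defines T on the law of Z (T_family_canonical).

    The maps S_2 and T are quantified over all probability spaces that carry the
    required families.  The joint law of such families is determined by their
    marginals (random_paths_joint_law), and both the convergence event and the
    limit are measurable functionals of the sample paths, so it is enough to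
    treat one realisation (T_limit_Zlaw, S2_sum_Zlaw). *)

Set Implicit Arguments.
Unset Strict Implicit.
Unset Printing Implicit Defensive.

(** * Independence of sigma-algebras and of random variables *)

Section pi_lambda.
Context d (Om : measurableType d) (R : realType) (P : probability Om R).

Lemma independent_generated_left (F : set_system Om) (B : set Om) :
  F `<=` measurable -> setI_closed F -> F setT -> measurable B ->
  (forall A, F A -> P (A `&` B) = (P A * P B)%E) ->
  forall A, <<s F >> A -> P (A `&` B) = (P A * P B)%E.
Proof.
move=> mF IF FT mB FB A sA.
have PBfin : P B \is a fin_num by rewrite fin_num_measure.
pose r : {nonneg R} := NngNum (fine_ge0 (measure_ge0 P B)).
have rE : (r%:num)%:E = P B by rewrite /= fineK.
have scaleE C : mscale r P C = (P C * P B)%E by rewrite /mscale rE muleC.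
have restrE C : mrestr P mB C = P (C `&` B) by [].
rewrite -scaleE -restrE.
apply: (@g_sigma_algebra_measure_unique d R Om F mF (fun=> setT)) => //.
- by rewrite bigcup_const.
- by move=> C FC; exact: (etrans (FB _ FC) (esym (scaleE _))).
- by move=> _; rewrite -[X in (X < _)%E]/(P (setT `&` B)) setTI ltey_eq PBfin.
Qed.

(** The pi-lambda theorem is used once in each argument: first for a fixed event of
    [G], then for a fixed event of the sigma-algebra generated by [F]. *)
Lemma independent_generated (F G : set_system Om) :
  F `<=` measurable -> setI_closed F -> F setT ->
  G `<=` measurable -> setI_closed G -> G setT ->
  independent_systems P F G ->
  independent_systems P <<s F >> <<s G >>.
Proof.
move=> mF IF FT mG IG GT FG A B sA sB.
have mA : measurable A.
  by apply: (smallest_sub _ mF) sA; exact: sigma_algebra_measurable.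
rewrite setIC muleC; apply: (independent_generated_left mG IG GT mA _ sB).
move=> C GC; rewrite setIC muleC.
by apply: (independent_generated_left mF IF FT (mG _ GC) _ sA) => D FD; exact: FG.
Qed.

End pi_lambda.

Section joint_law.
Context d1 d2 (T1 : measurableType d1) (T2 : measurableType d2) (R : realType).

(** Independence says that the joint law and the product of the marginals agree on
    rectangles, and the product measure is characterised by its values there. *)
Lemma joint_law d (Om : measurableType d) (P : probability Om R)
    (m1 : probability T1 R) (m2 : probability T2 R)
    (f : {RV P >-> T1}) (g : {RV P >-> T2}) :
  has_law f m1 -> has_law g m2 ->
  independent_systems P (g_sigma_algebra_preimage f)
    (g_sigma_algebra_preimage g) ->
  forall C, measurable C -> P ((fun x => (f x, g x)) @^-1` C) = (m1 \x m2)%E C.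
Proof.
move=> fm gm fg C mC.
have mfg : measurable_fun setT (fun x => (f x, g x)).
  by apply: measurable_fun_pair; exact: measurable_funPT.
pose h : {RV P >-> (T1 * T2)%type} := mfun_Sub (mem_set mfg).
rewrite -[LHS]/(distribution P h C); apply/esym.
apply: (@product_measure_unique _ _ _ _ _ m1 m2 (distribution P h)) => // A B mA mB.
transitivity (P (f @^-1` A `&` g @^-1` B)); first by [].
transitivity (distribution P f A * distribution P g B)%E.
  by apply: fg; [exists A|exists B]; rewrite ?setTI.
by congr (_ * _)%E; [exact: fm|exact: gm].
Qed.

End joint_law.

Section expectation_product.
Local Open Scope ereal_scope.
Context d (Om : measurableType d) (R : realType) (P : probability Om R).

(** Stated for non-negative extended reals, so that no integrability has to be
    checked: it is Tonelli's theorem for the joint law. *)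
Lemma expectation_product (f g : Om -> \bar R) :
  measurable_fun setT f -> measurable_fun setT g ->
  (forall x, 0 <= f x) -> (forall x, 0 <= g x) ->
  independent_systems P (g_sigma_algebra_preimage f)
    (g_sigma_algebra_preimage g) ->
  \int[P]_x (f x * g x) = (\int[P]_x f x) * (\int[P]_x g x).
Proof.
move=> mf mg f0 g0 fg.
pose F : {RV P >-> \bar R} := mfun_Sub (mem_set mf).
pose G : {RV P >-> \bar R} := mfun_Sub (mem_set mg).
pose m1 : probability (\bar R) R := distribution P F.
pose m2 : probability (\bar R) R := distribution P G.
pose prodp (z : \bar R * \bar R) := `|z.1| * `|z.2|.
have mprodp : measurable_fun setT prodp.
  by apply: emeasurable_funM; apply: measurableT_comp.
have mfg : measurable_fun setT (fun x => (F x, G x)).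
  by apply: measurable_fun_pair; exact: measurable_funPT.
pose H : {RV P >-> (\bar R * \bar R)%type} := mfun_Sub (mem_set mfg).
have -> : \int[P]_x (f x * g x) = \int[distribution P H]_z prodp z.
  rewrite ge0_integral_distribution//; last first.
    by move=> z; rewrite /prodp mule_ge0.
  by apply: eq_integral => x _; rewrite /prodp /= !gee0_abs.
have -> : \int[distribution P H]_z prodp z = \int[(m1 \x m2)%E]_z prodp z.
  apply: eq_measure_integral => C mC _.
  exact: (@joint_law _ _ _ _ R d Om P m1 m2 F G).
rewrite fubini_tonelli1//; last by move=> z; rewrite mule_ge0.
rewrite /fubini_F /prodp /=.
have mabs : measurable_fun [set: \bar R] (@abse R) by exact: abse_measurable.
under eq_integral do rewrite ge0_integralZl//.
rewrite ge0_integralZr//; last exact: integral_ge0.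
rewrite !ge0_integral_distribution//.
by congr (_ * _); apply: eq_integral => x _ /=; rewrite gee0_abs.
Qed.

End expectation_product.

(** * Dependence on part of an independent family *)

Section dependence.
Context d (Om : measurableType d) (R : realType) (P : probability Om R).
Context (I : choiceType) d' (E : measurableType d').
Variable X : I -> {RV P >-> E}.

Definition family_gens (D : set I) : set_system Om :=
  \bigcup_(i in D) g_sigma_algebra_preimage (X i).

(** Measurability for the sigma-algebra generated by the [X i] with [i] in [D],
    expressed as measurability on the copy of [Om] that carries this smaller
    sigma-algebra: the closure properties of measurable functions then apply
    verbatim to dependence. *)
Definition depends_on (D : set I) d'' (T : measurableType d'') (f : Om -> T) :=
  measurable_fun (setT : set (g_sigma_algebraType (family_gens D))) f.

(** The sets [B i] are measurable for every [i], not only on [J], so that a cylinder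
    can be rewritten over a larger finite set of indices. *)
Definition family_cylinders (D : set I) : set_system Om :=
  [set A | exists (J : {fset I}) (B : I -> set E),
    [/\ [set` J] `<=` D, (forall i, measurable (B i)) &
        A = \bigcap_(i in [set` J]) (X i @^-1` B i)]].

Lemma family_gens_measurable D : family_gens D `<=` measurable.
Proof.
move=> _ [i _ [B mB <-]]; rewrite setTI -[X i @^-1` B]setTI.
exact: measurable_funPT.
Qed.

Lemma family_sigma_measurable D : family_sigma_algebra D X `<=` measurable.
Proof.
move=> A; apply: (smallest_sub _ (@family_gens_measurable D)).
exact: sigma_algebra_measurable.
Qed.

Lemma family_sigma_sub D D' : D `<=` D' ->
  family_sigma_algebra D X `<=` family_sigma_algebra D' X.
Proof. by move=> DD'; apply: sub_smallest2r => //; exact: bigcup_subset. Qed.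

Lemma depends_on_measurable D d'' (T : measurableType d'') (f : Om -> T) :
  depends_on D f -> measurable_fun setT f.
Proof. by move=> Df _ A mA; apply: (@family_sigma_measurable D); exact: Df. Qed.

Lemma depends_on_preimage D d'' (T : measurableType d'') (f : Om -> T) :
  depends_on D f -> g_sigma_algebra_preimage f `<=` family_sigma_algebra D X.
Proof. by move=> Df _ [A mA <-]; exact: Df. Qed.

Lemma depends_on_sub D D' d'' (T : measurableType d'') (f : Om -> T) :
  D `<=` D' -> depends_on D f -> depends_on D' f.
Proof. by move=> DD' Df _ A mA; apply: (family_sigma_sub DD'); exact: Df. Qed.

Lemma depends_on_coordinate (D : set I) i : D i -> depends_on D (X i).
Proof.
by move=> Di _ A mA; apply: sub_sigma_algebra; exists i => //; exists A.
Qed.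

Lemma depends_on_indic D A : family_sigma_algebra D X A ->
  depends_on D (fun x => (\1_A x)%:E : \bar R).
Proof.
move=> DA; apply/measurable_EFinP.
exact: (@measurable_indic _ (g_sigma_algebraType (family_gens D))).
Qed.

Lemma cylinders_measurable D : family_cylinders D `<=` measurable.
Proof.
move=> _ [J [B [_ mB ->]]]; apply: fin_bigcap_measurable => // i _.
by rewrite -[X i @^-1` B i]setTI; exact: measurable_funPT.
Qed.

Lemma cylindersI D : setI_closed (family_cylinders D).
Proof.
move=> _ _ [J [B [JD mB ->]]] [J' [B' [JD' mB' ->]]].
exists (J `|` J')%fset.
exists (fun i => (if i \in J then B i else setT) `&`
  (if i \in J' then B' i else setT)); split.
- by move=> i /=; rewrite inE => /orP[/JD|/JD'].
- by move=> i; apply: measurableI; case: ifPn.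
- apply/seteqP; split=> x.
    move=> [xB xB'] i _; split; case: ifPn => //.
      exact: xB.
    exact: xB'.
  move=> xBB'; split=> i /= iJ.
    have [] := xBB' i; first by rewrite /= inE iJ.
    by rewrite iJ.
  have [] := xBB' i; first by rewrite /= inE iJ orbT.
  by rewrite iJ.
Qed.

Lemma cylindersT D : family_cylinders D setT.
Proof.
exists fset0, (fun=> setT); split => //.
by apply/esym; rewrite -subTset => x _ i.
Qed.

Lemma gens_cylinders D : family_gens D `<=` family_cylinders D.
Proof.
move=> _ [i Di [B mB <-]]; exists [fset i]%fset, (fun=> B); split => //.
  by move=> j /=; rewrite inE => /eqP ->.
rewrite setTI; apply/seteqP; split=> x /=.
  by move=> xB j /=; rewrite inE => /eqP ->.
by apply; rewrite /= inE.
Qed.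

Hypothesis indepX : independent_family setT X.

(** For two cylinders over disjoint finite sets, the product formula over the union
    of these sets splits; cylinders form a generating pi-system. *)
Lemma independent_disjoint D D' : [disjoint D & D'] ->
  independent_systems P (family_sigma_algebra D X) (family_sigma_algebra D' X).
Proof.
move=> /disj_setPS DD' A B DA DB.
apply: (@independent_generated _ _ _ P (family_cylinders D) (family_cylinders D')).
all: try exact: cylinders_measurable.
all: try exact: cylindersI.
all: try exact: cylindersT.
- move=> _ _ [J [C [JD mC ->]]] [J' [C' [JD' mC' ->]]].
  pose F i := if i \in J then C i else C' i.
  have JJ' i : i \in J -> i \in J' -> False.
    by move=> iJ iJ'; apply: (DD' i); split; [exact: JD|exact: JD'].
  have FJ i : i \in J -> F i = C i by rewrite /F => ->.
  have FJ' i : i \in J' -> F i = C' i.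
    by move=> iJ'; rewrite /F; case: ifPn => // iJ; case: (JJ' i).
  have -> : \bigcap_(i in [set` J]) (X i @^-1` C i) =
            \bigcap_(i in [set` J]) (X i @^-1` F i).
    by apply: eq_bigcapr => i /= iJ; rewrite FJ.
  have -> : \bigcap_(i in [set` J']) (X i @^-1` C' i) =
            \bigcap_(i in [set` J']) (X i @^-1` F i).
    by apply: eq_bigcapr => i /= iJ; rewrite FJ'.
  have mF i : measurable (F i) by rewrite /F; case: ifPn.
  rewrite -bigcap_setU.
  have -> : [set` J] `|` [set` J'] = [set` (J `|` J')%fset].
    by apply/seteqP; split => i /=; rewrite !inE => /orP.
  rewrite !indepX//.
  rewrite -big_cat; apply: perm_big.
  apply: uniq_perm => //.
    rewrite cat_uniq !fset_uniq andbT /=; apply/hasPn => i iJ'.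
    by apply/negP => iJ; exact: (JJ' i).
  by move=> i; rewrite mem_cat inE.
- by apply: (sub_smallest2r _ (@gens_cylinders D)) DA; exact: smallest_sigma_algebra.
- by apply: (sub_smallest2r _ (@gens_cylinders D')) DB; exact: smallest_sigma_algebra.
Qed.

Lemma expectation_disjoint D D' (f g : Om -> \bar R) :
  [disjoint D & D'] -> depends_on D f -> depends_on D' g ->
  (forall x, 0 <= f x)%E -> (forall x, 0 <= g x)%E ->
  (\int[P]_x (f x * g x) = (\int[P]_x f x) * (\int[P]_x g x))%E.
Proof.
move=> DD' Df Dg f0 g0; apply: expectation_product => //.
- exact: depends_on_measurable Df.
- exact: depends_on_measurable Dg.
- move=> A B /(depends_on_preimage Df) DA /(depends_on_preimage Dg) DB.
  exact: (independent_disjoint DD').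
Qed.

End dependence.

(** * Sample paths of independent families *)

Definition path_gens (I : Type) d' (E : measurableType d') :
    set_system (I -> E) :=
  \bigcup_i preimage_set_system setT (fun p : I -> E => p i) measurable.

Definition pathspace (I : Type) d' (E : measurableType d') :=
  g_sigma_algebraType (@path_gens I d' E).
HB.instance Definition _ (I : Type) d' (E : measurableType d') :=
  Measurable.on (@pathspace I d' E).

Section pathspace.
Context (I : choiceType) d' (E : measurableType d').

Lemma measurable_coordinate (i : I) :
  measurable_fun setT (fun p : pathspace I E => p i).
Proof.
by move=> _ A mA; apply: sub_sigma_algebra; exists i => //; exists A.
Qed.

Lemma measurable_to_path d (T : measurableType d) (f : T -> pathspace I E) :
  (forall i, measurable_fun setT (fun x => f x i)) -> measurable_fun setT f.
Proof.
move=> mf.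
refine (@measurability _ _ T (pathspace I E) setT f (@path_gens I _ E) _ _) => //.
move=> _ [_ [i _ [A mA <-]] <-]; rewrite !setTI -comp_preimage.
by have := mf i measurableT A mA; rewrite setTI.
Qed.

Context (R : realType).

Definition random_path d (Om : measurableType d) (P : probability Om R)
    (X : I -> {RV P >-> E}) (x : Om) : pathspace I E := fun i => X i x.

Lemma random_path_measurable d (Om : measurableType d) (P : probability Om R)
    (X : I -> {RV P >-> E}) : measurable_fun setT (random_path X).
Proof. by apply: measurable_to_path => i; exact: measurable_funPT. Qed.

Lemma random_path_depends d (Om : measurableType d) (P : probability Om R)
    (X : I -> {RV P >-> E}) : depends_on X setT (random_path X).
Proof. by apply: measurable_to_path => i; exact: depends_on_coordinate. Qed.

(** Both laws agree on the cylinders, by independence and equality of the marginals,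
    and the cylinders form a pi-system that generates the product sigma-algebra. *)
Lemma random_path_law d1 d2 (Om1 : measurableType d1) (Om2 : measurableType d2)
    (P1 : probability Om1 R) (P2 : probability Om2 R)
    (X1 : I -> {RV P1 >-> E}) (X2 : I -> {RV P2 >-> E}) (L : set E -> \bar R) :
  iid_family setT X1 L -> iid_family setT X2 L ->
  forall C, measurable C ->
    P1 (random_path X1 @^-1` C) = P2 (random_path X2 @^-1` C).
Proof.
move=> [i1 l1] [i2 l2] C mC.
pose H1 : {RV P1 >-> pathspace I E} :=
  mfun_Sub (mem_set (random_path_measurable X1)).
pose H2 : {RV P2 >-> pathspace I E} :=
  mfun_Sub (mem_set (random_path_measurable X2)).
pose Q : probability (pathspace I E) R := distribution P1 H1.
pose co i : {RV Q >-> E} := mfun_Sub (mem_set (@measurable_coordinate i)).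
apply: (@measure_unique _ R (pathspace I E) (family_cylinders co setT)
  (fun=> setT) _ _ _ _ (distribution P1 H1) (distribution P2 H2)) => //.
- apply/seteqP; split; last first.
    by apply: smallest_sub; [exact: sigma_algebra_measurable|exact: cylinders_measurable].
  apply: (sub_smallest2r _ (@gens_cylinders _ _ _ Q _ _ _ co setT)).
  exact: smallest_sigma_algebra.
- exact: cylindersI.
- by move=> _; exact: cylindersT.
- by rewrite bigcup_const.
- move=> _ [J [B [_ mB ->]]].
  transitivity (\prod_(i <- J) P1 (X1 i @^-1` B i))%E; first exact: i1.
  transitivity (\prod_(i <- J) P2 (X2 i @^-1` B i))%E; last by apply/esym; exact: i2.
  apply: eq_bigr => i _.
  by have := l1 i Logic.I (B i) (mB i); rewrite -(l2 i Logic.I).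
- by move=> _; rewrite [X in (X < _)%E]probability_setT ltry.
Qed.

End pathspace.

(** This is what allows a statement about all realisations of a pair of families to
    be proved on a single one. *)
Lemma random_paths_joint_law (R : realType) (I1 I2 : choiceType)
    e1 e2 (E1 : measurableType e1) (E2 : measurableType e2)
    (L1 : set E1 -> \bar R) (L2 : set E2 -> \bar R)
    d1 d2 (Om1 : measurableType d1) (Om2 : measurableType d2)
    (P1 : probability Om1 R) (P2 : probability Om2 R)
    (X1 : I1 -> {RV P1 >-> E1}) (W1 : I2 -> {RV P1 >-> E2})
    (X2 : I1 -> {RV P2 >-> E1}) (W2 : I2 -> {RV P2 >-> E2}) :
  iid_family setT X1 L1 -> iid_family setT X2 L1 ->
  iid_family setT W1 L2 -> iid_family setT W2 L2 ->
  independent_systems P1 (family_sigma_algebra setT X1)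
    (family_sigma_algebra setT W1) ->
  independent_systems P2 (family_sigma_algebra setT X2)
    (family_sigma_algebra setT W2) ->
  forall C, measurable C ->
    P1 ((fun x => (random_path X1 x, random_path W1 x)) @^-1` C) =
    P2 ((fun x => (random_path X2 x, random_path W2 x)) @^-1` C).
Proof.
move=> hX1 hX2 hW1 hW2 ind1 ind2 C mC.
pose H1 : {RV P1 >-> pathspace I1 E1} :=
  mfun_Sub (mem_set (random_path_measurable X1)).
pose K1 : {RV P1 >-> pathspace I2 E2} :=
  mfun_Sub (mem_set (random_path_measurable W1)).
pose H2 : {RV P2 >-> pathspace I1 E1} :=
  mfun_Sub (mem_set (random_path_measurable X2)).
pose K2 : {RV P2 >-> pathspace I2 E2} :=
  mfun_Sub (mem_set (random_path_measurable W2)).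
pose m1 : probability (pathspace I1 E1) R := distribution P1 H1.
pose m2 : probability (pathspace I2 E2) R := distribution P1 K1.
transitivity ((m1 \x m2)%E C).
  apply: (@joint_law _ _ _ _ R _ Om1 P1 m1 m2 H1 K1) => //.
  move=> A B HA KB; apply: ind1.
    exact: (depends_on_preimage (@random_path_depends _ _ _ _ _ _ _ X1)).
  exact: (depends_on_preimage (@random_path_depends _ _ _ _ _ _ _ W1)).
apply/esym/(@joint_law _ _ _ _ R _ Om2 P2 m1 m2 H2 K2) => //.
- by move=> B mB; exact: (random_path_law hX2 hX1).
- by move=> B mB; exact: (random_path_law hW2 hW1).
move=> A B HA KB; apply: ind2.
  exact: (depends_on_preimage (@random_path_depends _ _ _ _ _ _ _ X2)).
exact: (depends_on_preimage (@random_path_depends _ _ _ _ _ _ _ W2)).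
Qed.

Section groups.
Context d (Om : measurableType d) (R : realType) (P : probability Om R).
Context (I K : choiceType) d' d'' (E : measurableType d') (T : measurableType d'').
Variables (X : I -> {RV P >-> E}) (W : K -> {RV P >-> T}) (D : K -> set I).
Hypothesis indepX : independent_family setT X.
Hypothesis WD : forall k, depends_on X (D k) (W k).

Lemma family_depends_sub (F : set K) :
  family_sigma_algebra F W `<=` family_sigma_algebra (\bigcup_(k in F) D k) X.
Proof.
apply: smallest_sub; first exact: smallest_sigma_algebra.
move=> A [k Fk]; move=> /(depends_on_preimage (@WD k)).
by apply: family_sigma_sub; exact: bigcup_sup.
Qed.

(** The groups are split off one at a time: what remains depends on the union of
    the other groups. *)
Lemma independent_groups : (forall k l, k != l -> [disjoint D k & D l]) ->
  independent_family setT W.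
Proof.
move=> DD J B _ mB.
suff H (s : seq K) : uniq s -> {subset s <= J} ->
    P (\bigcap_(i in [set` s]) (W i @^-1` B i)) =
    (\prod_(i <- s) P (W i @^-1` B i))%E.
  exact: H.
elim: s => [_ _|k s IH /= /andP[ks us] sJ].
  by rewrite big_nil set_nil bigcap_set0 probability_setT.
have sJ' : {subset s <= J} by move=> i si; apply: sJ; rewrite inE si orbT.
have kJ : k \in J by apply: sJ; rewrite inE eqxx.
have set_consE : [set` k :: s] = k |` [set` s].
  by apply/seteqP; split=> i /=; rewrite inE => /predU1P.
rewrite big_cons -(IH us sJ') set_consE bigcap_setU1.
apply: (independent_disjoint indepX (D := D k) (D' := \bigcup_(l in [set` s]) D l)).
- apply/disj_setPS => i [Dki [l /= ls Dli]].
  have kl : k != l by apply: contraNneq ks => ->.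
  by have /disj_setPS/(_ i) := DD _ _ kl; apply.
- by apply: (depends_on_preimage (@WD k)); exists (B k); rewrite ?setTI//; exact: mB.
- apply: family_depends_sub.
  apply: (@fin_bigcap_measurable _ (g_sigma_algebraType (family_gens W [set` s])))
    => // i si.
  by apply: sub_sigma_algebra; exists i => //; exists (B i); rewrite ?setTI//; exact/mB/sJ'.
Qed.

End groups.

(** * Series of non-negative extended reals, words and the cascade *)

Section nneseries_more.
Local Open Scope ereal_scope.
Context (R : realType).
Implicit Types f : nat -> \bar R.

(** The factor may be infinite, a case that the continuity of multiplication does
    not cover. *)
Lemma ge0_nneseriesZl f (x : \bar R) : 0 <= x -> (forall i, 0 <= f i) ->
  \sum_(0 <= i <oo) (x * f i) = x * \sum_(0 <= i <oo) f i.
Proof.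
move=> x0 f0; case: x x0 => [r _| _|//]; first by rewrite nneseriesZl.
have [[i fi]|/forallNP f00] := pselect (exists i, 0 < f i).
  rewrite [LHS](nneseries_pinfty (k := i))//; last 2 first.
  - by move=> n _; rewrite mule_ge0.
  - by rewrite gt0_mulye.
  rewrite gt0_mulye// (lt_le_trans fi)// (nneseriesD1 (n := i))//.
  by rewrite leeDl//; exact: nneseries_ge0.
have f0E i : f i = 0.
  by apply/eqP; rewrite eq_le f0 andbT leNgt; apply/negP => fi; exact: (f00 i).
by rewrite !eseries0 ?mule0// => i _ _; rewrite f0E ?mule0.
Qed.

Lemma ge0_nneseriesZr f (x : \bar R) : 0 <= x -> (forall i, 0 <= f i) ->
  \sum_(0 <= i <oo) (f i * x) = (\sum_(0 <= i <oo) f i) * x.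
Proof.
move=> x0 f0; rewrite muleC -ge0_nneseriesZl//.
by apply: eq_eseriesr => i _; rewrite muleC.
Qed.

Lemma nneseries_mul f g : (forall i, 0 <= f i) -> (forall i, 0 <= g i) ->
  (\sum_(0 <= i <oo) f i) * (\sum_(0 <= j <oo) g j) =
  \sum_(0 <= i <oo) \sum_(0 <= j <oo) (f i * g j).
Proof.
move=> f0 g0; rewrite -ge0_nneseriesZr//; last exact: nneseries_ge0.
by apply: eq_eseriesr => i _; rewrite ge0_nneseriesZl.
Qed.

Lemma nneseries_only f n : (forall i, 0 <= f i) -> (forall i, i != n -> f i = 0) ->
  \sum_(0 <= i <oo) f i = f n.
Proof.
move=> f0 fn; rewrite (nneseriesD1 (n := n))// eseries_mkcond eseries0 ?adde0//.
by move=> i _ _ /=; case: ifPn => // /fn.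
Qed.

End nneseries_more.

Notation word := (seq (nat * bool)).

Section words.
Implicit Types (s t : word) (c : nat * bool).

(** A pair of words of equal length is encoded as one word over pairs; the
    descendants of a node are then the words that extend it. *)
Definition subtree s : set word := [set t | prefix s t].

Lemma subtree_refl s : subtree s s.
Proof. exact: prefix_refl. Qed.

Lemma subtree_rcons s c : subtree (rcons s c) `<=` subtree s.
Proof. by move=> t; apply: prefix_trans; rewrite -cats1; exact: prefix_prefix. Qed.

Lemma subtree_size s t : subtree s t -> (size s <= size t)%N.
Proof. exact: size_prefix. Qed.

Lemma subtree_rcons_notin s c : ~ subtree (rcons s c) s.
Proof. by move=> /subtree_size; rewrite size_rcons ltnn. Qed.

Lemma subtree_nth s c t : subtree (rcons s c) t -> nth c t (size s) = c.
Proof.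
by move=> /prefixP[u ->]; rewrite cat_rcons nth_cat ltnn subnn.
Qed.

Lemma subtree_rcons_disj s c c' : c != c' ->
  [disjoint subtree (rcons s c) & subtree (rcons s c')].
Proof.
move=> cc'; apply/disj_setPS => t [tc tc']; apply: (negP cc').
apply/eqP; rewrite -[LHS](subtree_nth tc) -[RHS](subtree_nth tc').
apply: set_nth_default; move/subtree_size: tc; by rewrite size_rcons.
Qed.

End words.

Section cascade.
Local Open Scope ereal_scope.
Context (R : realType).

Lemma measurable_Rseq j : measurable_fun setT (fun r : Rseq R => r j).
Proof.
by move=> _ A mA; apply: sub_sigma_algebra; exists j => //; exists A.
Qed.

(** The absolute value makes the series below well defined and measurable on every
    path; it is harmless on the paths with non-negative entries. *)
Definition weight (r : Rseq R) j : \bar R := (`|r j|)%:E.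

Lemma weight_ge0 r j : 0 <= weight r j. Proof. by rewrite lee_fin. Qed.

Lemma measurable_weight j : measurable_fun setT (weight^~ j).
Proof.
apply/measurable_EFinP; apply: measurableT_comp => //.
exact: measurable_Rseq.
Qed.

Lemma measurable_weight_RV d (Om : measurableType d) (P : probability Om R)
    (Y : {RV P >-> Rseq R}) j : measurable_fun setT (fun x => weight (Y x) j).
Proof. by apply: measurableT_comp (measurable_weight j) _; exact: measurable_funPT. Qed.

(** The variable Z_n of the node [s] as a functional of the whole family of weights,
    so that it can be evaluated on any realisation; Z_0 = 1 makes Z_1 the sum of the
    weights. *)
Fixpoint cascade n (s : word) (p : pathspace word (Rseq R)) : \bar R :=
  if n is k.+1 then
    \sum_(0 <= j <oo) (weight (p s) j * cascade k (rcons s (j, false)) p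
                       * cascade k (rcons s (j, true)) p)
  else 1.

Lemma cascade_ge0 n s p : 0 <= cascade n s p.
Proof.
elim: n s => [|n IH] s //=; apply: nneseries_ge0 => j _ _.
by rewrite !mule_ge0// weight_ge0.
Qed.

Lemma measurable_cascade n s : measurable_fun setT (cascade n s).
Proof.
elim: n s => [|n IH] s; first exact: measurable_cst.
apply: ge0_emeasurable_sum => [k x _ _|k _].
  by rewrite !mule_ge0// ?weight_ge0 ?cascade_ge0.
apply: emeasurable_funM => //; apply: emeasurable_funM => //.
apply: measurableT_comp (measurable_weight k) _.
exact: (@measurable_coordinate _ _ (Rseq R) s).
Qed.

(** The cascade below a node is the cascade of the shifted path, hence has the same
    law as the one at the root. *)
Lemma cascade_shift n s t p :
  cascade n (s ++ t) p = cascade n t (fun u => p (s ++ u)).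
Proof.
elim: n t => [//|n IH] t /=; apply: eq_eseriesr => j _.
by rewrite -!IH !rcons_cat.
Qed.

End cascade.

(** * Moments and the martingale property of the cascade *)

Section moments.
Local Open Scope ereal_scope.
Context (R : realType) d0 (Om0 : measurableType d0) (P0 : probability Om0 R).
Variable a0 : {RV P0 >-> Rseq R}.
Context d (Om : measurableType d) (P : probability Om R).
Variable X : word -> {RV P >-> Rseq R}.
Hypothesis X_iid : iid_family setT X (distribution P0 a0).

Definition total (r : Rseq R) : \bar R := \sum_(0 <= j <oo) weight r j.

Definition moment i j : \bar R := \int[P0]_y (weight (a0 y) i * weight (a0 y) j).
Definition diag_moment : \bar R := \sum_(0 <= i <oo) moment i i.
Definition offdiag_moment : \bar R :=
  \sum_(0 <= i <oo) \sum_(0 <= j <oo) (if i == j then 0 else moment i j).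

Lemma moment_ge0 i j : 0 <= moment i j.
Proof. by apply: integral_ge0 => y _; rewrite mule_ge0// weight_ge0. Qed.

Lemma diag_moment_ge0 : 0 <= diag_moment.
Proof. by apply: nneseries_ge0 => i _ _; exact: moment_ge0. Qed.

Lemma total_ge0 r : 0 <= total r.
Proof. by apply: nneseries_ge0 => i _ _; exact: weight_ge0. Qed.

Lemma measurable_total : measurable_fun setT total.
Proof.
apply: ge0_emeasurable_sum => [k x _ _|k _]; first exact: weight_ge0.
exact: measurable_weight.
Qed.

Lemma integral_same_law s (f : Rseq R -> \bar R) :
  measurable_fun setT f -> (forall r, 0 <= f r) ->
  \int[P]_x f (X s x) = \int[P0]_y f (a0 y).
Proof.
move=> mf f0.
rewrite -[LHS](ge0_integral_distribution (X s))// -[RHS](ge0_integral_distribution a0)//.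
apply: eq_measure_integral => A mA _; exact: (X_iid.2 s Logic.I).
Qed.

Let indepX : independent_family setT X := X_iid.1.

Lemma weight_depends D s j : D s -> depends_on X D (fun x => weight (X s x) j).
Proof.
move=> Ds; apply: measurableT_comp (measurable_weight j) _.
exact: (depends_on_coordinate (X := X) Ds).
Qed.

Lemma depends_on_cst D (c : \bar R) : depends_on X D (fun=> c).
Proof. exact: measurable_cst. Qed.

Lemma depends_on_mul D (f g : Om -> \bar R) :
  depends_on X D f -> depends_on X D g -> depends_on X D (fun x => f x * g x).
Proof. exact: emeasurable_funM. Qed.

Lemma depends_on_series D (f : nat -> Om -> \bar R) :
  (forall j x, 0 <= f j x) -> (forall j, depends_on X D (f j)) ->
  depends_on X D (fun x => \sum_(0 <= j <oo) f j x).
Proof.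
move=> f0 Df.
apply: (@ge0_emeasurable_sum _ (g_sigma_algebraType (family_gens X D)) R setT f xpredT).
- by move=> j x _ _; exact: f0.
- by move=> j _; exact: Df.
Qed.

Definition branching (s : word) (U : nat -> Om -> \bar R) (x : Om) : \bar R :=
  \sum_(0 <= j <oo) (weight (X s x) j * U j x).

Lemma branching_ge0 s U x : (forall j x, 0 <= U j x) -> 0 <= branching s U x.
Proof. by move=> U0; apply: nneseries_ge0 => j _ _; rewrite mule_ge0// weight_ge0. Qed.

Lemma branching_depends D s U : (forall j x, 0 <= U j x) -> D s ->
  (forall j, depends_on X D (U j)) -> depends_on X D (branching s U).
Proof.
move=> U0 Ds DU; apply: depends_on_series => [j x|j].
  by rewrite mule_ge0// weight_ge0.
by apply: depends_on_mul => //; exact: weight_depends.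
Qed.

(** The two series are multiplied out.  The term of index [(i, j)] splits into the
    weights at [s] and the variables below [s]; the latter contribute [c] on the
    diagonal and, by independence, [1 * 1] off it. *)
Lemma branching_second_moment s (D : nat -> set word)
    (U V : nat -> Om -> \bar R) (c : \bar R) :
  (forall j, ~ D j s) -> (forall i j, i != j -> [disjoint D i & D j]) ->
  (forall j, depends_on X (D j) (U j)) -> (forall j, depends_on X (D j) (V j)) ->
  (forall j x, 0 <= U j x) -> (forall j x, 0 <= V j x) ->
  (forall j, \int[P]_x U j x = 1) -> (forall j, \int[P]_x V j x = 1) ->
  (forall j, \int[P]_x (U j x * V j x) = c) ->
  \int[P]_x (branching s U x * branching s V x) = diag_moment * c + offdiag_moment.
Proof.
move=> Ds DD DU DV U0 V0 EU EV EUV.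
have c0 : 0 <= c by rewrite -(EUV 0%N); apply: integral_ge0 => x _; rewrite mule_ge0.
have mU j : measurable_fun setT (U j) := depends_on_measurable (DU j).
have mV j : measurable_fun setT (V j) := depends_on_measurable (DV j).
have mA := measurable_weight_RV (X s).
have E2 i j : \int[P]_x (weight (X s x) i * U i x * (weight (X s x) j * V j x)) =
    if i == j then moment i i * c else moment i j.
  transitivity (moment i j * \int[P]_x (U i x * V j x)).
    transitivity (\int[P]_x ((weight (X s x) i * weight (X s x) j) * (U i x * V j x))).
      by apply: eq_integral => x _; rewrite muleACA.
    rewrite (expectation_disjoint indepX (D := [set s]) (D' := D i `|` D j)).
    - congr (_ * _).
      apply: (integral_same_law s (f := fun r => weight r i * weight r j)).
        by apply: emeasurable_funM; exact: measurable_weight.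
      by move=> r; rewrite mule_ge0// weight_ge0.
    - by apply/disj_setPS => t [/= -> [/Ds|/Ds]].
    - by apply: depends_on_mul; exact: weight_depends.
    - apply: depends_on_mul.
        by apply: depends_on_sub (DU i); exact: subsetUl.
      by apply: depends_on_sub (DV j); exact: subsetUr.
    - by move=> x; rewrite mule_ge0// weight_ge0.
    - by move=> x; rewrite mule_ge0.
  case: ifPn => [/eqP <-|ij]; first by rewrite EUV.
  rewrite (expectation_disjoint indepX (DD _ _ ij) (DU i) (DV j))//.
  by rewrite EU EV !mule1.
transitivity (\sum_(0 <= i <oo) \sum_(0 <= j <oo)
    if i == j then moment i i * c else moment i j).
  transitivity (\int[P]_x \sum_(0 <= i <oo) \sum_(0 <= j <oo)
      (weight (X s x) i * U i x * (weight (X s x) j * V j x))).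
    by apply: eq_integral => x _; rewrite nneseries_mul// => i;
      rewrite mule_ge0// weight_ge0.
  rewrite integral_nneseries//; last first.
  - by move=> i x _; apply: nneseries_ge0 => j _ _; rewrite !mule_ge0// weight_ge0.
  - move=> i; apply: ge0_emeasurable_sum => [j x _ _|j _].
      by rewrite !mule_ge0// weight_ge0.
    by apply: emeasurable_funM; exact: emeasurable_funM.
  apply: eq_eseriesr => i _; rewrite integral_nneseries//; last first.
  - by move=> j x _; rewrite !mule_ge0// weight_ge0.
  - by move=> j; apply: emeasurable_funM; exact: emeasurable_funM.
  by apply: eq_eseriesr => j _; exact: E2.
rewrite -ge0_nneseriesZr//; last by move=> i; exact: moment_ge0.
rewrite -nneseriesD.
- apply: eq_eseriesr => i _.
  transitivity (\sum_(0 <= j <oo) ((if i == j then moment i i * c else 0) +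
      (if i == j then 0 else moment i j))).
    by apply: eq_eseriesr => j _; case: ifP => _; rewrite ?adde0 ?add0e.
  rewrite nneseriesD; [|by move=> j _ _; case: ifP => // _; rewrite mule_ge0// moment_ge0
                      |by move=> j _ _; case: ifP => // _; rewrite moment_ge0].
  congr (_ + _); rewrite (nneseries_only (n := i)) ?eqxx//.
    by move=> j; case: ifP => // _; rewrite mule_ge0// moment_ge0.
  by move=> j; rewrite eq_sym => /negbTE ->.
- by move=> i _ _; rewrite mule_ge0// moment_ge0.
- by move=> i _ _; apply: nneseries_ge0 => j _ _; case: ifP => // _; rewrite moment_ge0.
Qed.

(** The case of the preceding formula where all the variables are 1. *)
Lemma total_second_moment :
  \int[P0]_y (total (a0 y) * total (a0 y)) = diag_moment + offdiag_moment.
Proof.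
rewrite -(integral_same_law [::] (f := fun r => total r * total r)); last 2 first.
- by apply: emeasurable_funM; exact: measurable_total.
- by move=> r; rewrite mule_ge0// total_ge0.
have E1 : \int[P]_x (cst 1 x : \bar R) = 1.
  by rewrite integral_cst// mul1e; exact: probability_setT.
transitivity (\int[P]_x (branching [::] (fun=> cst 1) x * branching [::] (fun=> cst 1) x)).
  by apply: eq_integral => x _; congr (_ * _); apply: eq_eseriesr => j _; rewrite mule1.
rewrite (branching_second_moment (D := fun=> set0) (c := 1)) ?mule1//.
- by move=> j [].
- by move=> i j _; apply/disj_setPS => t [].
- by move=> j; exact: depends_on_cst.
- by move=> j; exact: depends_on_cst.
- by move=> j; rewrite -[RHS]E1; apply: eq_integral => x _; rewrite mule1.
Qed.

Lemma branching_mean s (D : nat -> set word) (U : nat -> Om -> \bar R) :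
  (forall j, ~ D j s) -> (forall j, depends_on X (D j) (U j)) ->
  (forall j x, 0 <= U j x) -> (forall j, \int[P]_x U j x = 1) ->
  \int[P]_x branching s U x = \int[P0]_y total (a0 y).
Proof.
move=> Ds DU U0 EU.
have mU j : measurable_fun setT (U j) := depends_on_measurable (DU j).
have mA := measurable_weight_RV (X s).
rewrite integral_nneseries//; last first.
- by move=> i x _; rewrite mule_ge0// weight_ge0.
- by move=> j; exact: emeasurable_funM.
rewrite -(integral_same_law s measurable_total total_ge0) integral_nneseries//; last first.
  by move=> j x _; exact: weight_ge0.
apply: eq_eseriesr => j _.
rewrite (expectation_disjoint indepX (D := [set s]) (D' := D j)) ?EU ?mule1//.
- by apply/disj_setPS => t [/= -> /Ds].
- exact: weight_depends.
- by move=> x; exact: weight_ge0.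
Qed.

Definition Zr n s (x : Om) : \bar R := cascade n s (random_path X x).

Lemma Zr_ge0 n s x : 0 <= Zr n s x. Proof. exact: cascade_ge0. Qed.

Lemma ZrS n s x : Zr n.+1 s x =
  branching s (fun j y => Zr n (rcons s (j, false)) y * Zr n (rcons s (j, true)) y) x.
Proof. by apply: eq_eseriesr => j _; rewrite muleA. Qed.

(** The sharp set of indices, with its bound on the length, is what adaptedness of
    the martingale requires. *)
Lemma Zr_depends n s :
  depends_on X [set t | prefix s t /\ (size t < size s + n)%N] (Zr n s).
Proof.
elim: n s => [|n IH] s; first exact: depends_on_cst.
have -> : Zr n.+1 s = branching s (fun j y =>
    Zr n (rcons s (j, false)) y * Zr n (rcons s (j, true)) y).
  by apply/funext => x; exact: ZrS.
apply: branching_depends => [j x||j].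
- by rewrite mule_ge0// Zr_ge0.
- by split; [exact: prefix_refl|rewrite addnS ltnS leq_addr].
- by apply: depends_on_mul; apply: depends_on_sub (IH _) => t [/= p];
    rewrite size_rcons addSnnS => ?; split => //; exact: (subtree_rcons p).
Qed.

Lemma Zr_depends_subtree n s : depends_on X (subtree s) (Zr n s).
Proof. by apply: depends_on_sub (@Zr_depends n s) => t []. Qed.

Lemma Zr_measurable n s : measurable_fun setT (Zr n s).
Proof. exact: depends_on_measurable (@Zr_depends n s). Qed.

Definition children s j : set word :=
  subtree (rcons s (j, false)) `|` subtree (rcons s (j, true)).

Lemma children_notin s j : ~ children s j s.
Proof. by move=> [|]; exact: subtree_rcons_notin. Qed.

Lemma children_disj s i j : i != j -> [disjoint children s i & children s j].
Proof.
move=> ij; apply/disj_setPS => t [ti tj].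
have sub b k u : subtree (rcons s (k, b)) u -> nth 0%N (map fst u) (size s) = k.
  move=> uk; rewrite (nth_map (k, b)) ?(subtree_nth uk)//.
  by move/subtree_size: uk; rewrite size_rcons.
have subc k u : children s k u -> nth 0%N (map fst u) (size s) = k.
  by move=> [|]; exact: sub.
by move/negP: ij; apply; rewrite -(subc _ _ ti) -(subc _ _ tj).
Qed.

Hypothesis a0_mean : \int[P0]_y total (a0 y) = 1.

(** Passing from rank [n] to rank [n.+1] adds the weights of the descendants of [s]
    at depth [n].  The induction replaces the two factors below each child one
    after the other, the other factor being absorbed in the test function; this is
    why [H] may depend on everything except these weights and deeper ones below
    [s], and not merely on the past. *)
Lemma martingale_step n s (H : Om -> \bar R) :
  depends_on X [set t | ~ (prefix s t /\ (size s + n <= size t)%N)] H ->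
  (forall x, 0 <= H x) ->
  \int[P]_x (H x * Zr n.+1 s x) = \int[P]_x (H x * Zr n s x).
Proof.
elim: n s H => [|n IH] s H DH H0.
  have -> : \int[P]_x (H x * Zr 0 s x) = \int[P]_x H x.
    by apply: eq_integral => x _; rewrite /Zr /= mule1.
  rewrite (expectation_disjoint indepX (D := ~` [set s]) (D' := [set s])).
  - rewrite -[RHS]mule1; congr (_ * _).
    rewrite -a0_mean -(integral_same_law s measurable_total total_ge0).
    by apply: eq_integral => x _; apply: eq_eseriesr => j _; rewrite /= !mule1.
  - by apply/disj_setPS => t [].
  - by apply: depends_on_sub DH => t /= nt ts; apply: nt; rewrite ts addn0 prefix_refl.
  - by apply: depends_on_sub (@Zr_depends 1 s) => t [/prefixP[u ->]];
      rewrite size_cat ltn_add2l ltnS leqn0 => /nilP ->; rewrite cats0.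
  - exact: H0.
  - exact: Zr_ge0.
have mH : measurable_fun setT H by exact: depends_on_measurable DH.
have mA := measurable_weight_RV (X s).
have swap k : \int[P]_x (H x * Zr k.+1 s x) = \sum_(0 <= j <oo)
    \int[P]_x (H x * (weight (X s x) j * Zr k (rcons s (j, false)) x
        * Zr k (rcons s (j, true)) x)).
  rewrite -integral_nneseries//.
  - apply: eq_integral => x _; rewrite ge0_nneseriesZl// => j.
    by rewrite !mule_ge0// ?Zr_ge0// weight_ge0.
  - move=> j; apply: emeasurable_funM => //.
    by apply: emeasurable_funM; [apply: emeasurable_funM => //|]; exact: Zr_measurable.
  - by move=> j x _; rewrite !mule_ge0// ?Zr_ge0// weight_ge0.
rewrite !swap; apply: eq_eseriesr => j _.
have subD c : [set t | ~ (prefix s t /\ (size s + n.+1 <= size t)%N)] `<=`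
    [set t | ~ (prefix (rcons s c) t /\ (size (rcons s c) + n <= size t)%N)].
  move=> t /= nt [p]; rewrite size_rcons addSnnS => ?; apply: nt; split => //.
  exact: (subtree_rcons p).
have sibling b k : depends_on X [set t | ~ (prefix (rcons s (j, b)) t /\
    (size (rcons s (j, b)) + n <= size t)%N)] (Zr k (rcons s (j, ~~ b))).
  apply: depends_on_sub (@Zr_depends_subtree _ _) => t tb [tb' _].
  have /(@subtree_rcons_disj s)/disj_setPS/(_ t) : (j, ~~ b) != (j, b).
    by rewrite xpair_eqE eqxx; case: (b).
  by apply; split.
have root b : [set t | ~ (prefix (rcons s (j, b)) t /\
    (size (rcons s (j, b)) + n <= size t)%N)] s.
  by move=> [/(@subtree_rcons_notin s)].
transitivity (\int[P]_x (H x * (weight (X s x) j * Zr n.+1 (rcons s (j, false)) x)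
    * Zr n.+1 (rcons s (j, true)) x)).
  by apply: eq_integral => x _; rewrite !muleA.
rewrite IH; last 2 first.
- apply: depends_on_mul; first exact: depends_on_sub DH.
  by apply: depends_on_mul; [exact: weight_depends|exact: (sibling true)].
- by move=> x; rewrite !mule_ge0// ?Zr_ge0// weight_ge0.
transitivity (\int[P]_x (H x * (weight (X s x) j * Zr n (rcons s (j, true)) x)
    * Zr n.+1 (rcons s (j, false)) x)).
  by apply: eq_integral => x _; rewrite -!muleA; congr (_ * (_ * _)); rewrite muleC.
rewrite IH; last 2 first.
- apply: depends_on_mul; first exact: depends_on_sub DH.
  by apply: depends_on_mul; [exact: weight_depends|exact: (sibling false)].
- by move=> x; rewrite !mule_ge0// ?Zr_ge0// weight_ge0.
by apply: eq_integral => x _; rewrite -!muleA; congr (_ * (_ * _)); rewrite muleC.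
Qed.

Lemma martingale_le n m s (H : Om -> \bar R) : (n <= m)%N ->
  depends_on X [set t | ~ (prefix s t /\ (size s + n <= size t)%N)] H ->
  (forall x, 0 <= H x) ->
  \int[P]_x (H x * Zr m s x) = \int[P]_x (H x * Zr n s x).
Proof.
move=> nm DH H0; rewrite -(subnKC nm); elim: (m - n)%N => [|k IH]; first by rewrite addn0.
rewrite addnS martingale_step//.
apply: depends_on_sub DH => t nt [p st]; apply: nt; split => //.
by apply: leq_trans st; rewrite leq_add2l leq_addr.
Qed.

Lemma Zr_past n m s : (n <= m)%N ->
  depends_on X [set t | ~ (prefix s t /\ (size s + m <= size t)%N)] (Zr n s).
Proof.
move=> nm; apply: depends_on_sub (@Zr_depends n s) => t /= [_ tn] [_ tm].
by move: (leq_ltn_trans tm tn); rewrite ltn_add2l ltnNge nm.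
Qed.

Lemma Zr_mean n s : \int[P]_x Zr n s x = 1.
Proof.
have := @martingale_le 0 n s (cst 1) (leq0n _) (@depends_on_cst _ _) (fun=> lee01).
rewrite (eq_integral (fun x => Zr n s x)) => [->|x _]; last by rewrite mul1e.
rewrite (eq_integral (cst 1)) => [|x _]; last by rewrite mul1e.
by rewrite integral_cst// mul1e; exact: probability_setT.
Qed.

End moments.

(** * Squared distances in L^2 *)

Section squared_distance.
Local Open Scope ereal_scope.
Context (R : realType) d (Om : measurableType d) (P : probability Om R).
Implicit Types f g h : Om -> \bar R.

Definition sqdist f g x := `|f x - g x| ^+ 2.

Lemma sqdist_ge0 f g x : 0 <= sqdist f g x.
Proof. exact: sqre_ge0. Qed.

Lemma measurable_sqdist f g : measurable_fun setT f -> measurable_fun setT g ->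
  measurable_fun setT (sqdist f g).
Proof.
move=> mf mg; rewrite (_ : sqdist f g = fun x => `|f x - g x| * `|f x - g x|).
  by apply: emeasurable_funM; apply: measurableT_comp => //; exact: emeasurable_funB.
by apply/funext => x; rewrite /sqdist expe2.
Qed.

Lemma ge0_ae_fin f : measurable_fun setT f -> (forall x, 0 <= f x) ->
  \int[P]_x f x < +oo -> {ae P, forall x, f x \is a fin_num}.
Proof.
move=> mf f0 fi.
have /(integrable_ae measurableT) : P.-integrable setT f.
  by apply/integrableP; split => //; under eq_integral do rewrite gee0_abs//.
by apply: filterS => x; apply.
Qed.

Lemma square_integrable_ae_fin f : measurable_fun setT f -> (forall x, 0 <= f x) ->
  \int[P]_x (f x * f x) < +oo -> {ae P, forall x, f x \is a fin_num}.
Proof.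
move=> mf f0 fi.
have := ge0_ae_fin (emeasurable_funM mf mf) (fun x => mule_ge0 (f0 x) (f0 x)) fi.
apply: filterS => x /=; move: (f0 x); case: (f x) => // _.
Qed.

(** The expansion of a square, with the cross term moved to the left so that all
    terms are non-negative and none has to be integrable. *)
Lemma sqdist_weighted h f g :
  measurable_fun setT h -> measurable_fun setT f -> measurable_fun setT g ->
  (forall x, 0 <= h x) -> (forall x, 0 <= f x) -> (forall x, 0 <= g x) ->
  {ae P, forall x, f x \is a fin_num} -> {ae P, forall x, g x \is a fin_num} ->
  \int[P]_x (h x * sqdist f g x) + 2%:E * \int[P]_x (h x * (f x * g x)) =
  \int[P]_x (h x * (f x * f x)) + \int[P]_x (h x * (g x * g x)).
Proof.
move=> mh mf mg h0 f0 g0 ff gf.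
have md := measurable_sqdist mf mg.
have d0 := sqdist_ge0 f g.
have mfg := emeasurable_funM mf mg.
have mff := emeasurable_funM mf mf.
have mgg := emeasurable_funM mg mg.
have mhd := emeasurable_funM mh md.
have mhfg := emeasurable_funM mh mfg.
have mhff := emeasurable_funM mh mff.
have mhgg := emeasurable_funM mh mgg.
have m2 : measurable_fun setT (fun x => 2%:E * (h x * (f x * g x))).
  exact: emeasurable_funM.
have hd0 x : setT x -> 0 <= h x * sqdist f g x by move=> _; rewrite mule_ge0.
have hfg0 x : setT x -> 0 <= h x * (f x * g x) by move=> _; rewrite !mule_ge0.
have hff0 x : setT x -> 0 <= h x * (f x * f x) by move=> _; rewrite !mule_ge0.
have hgg0 x : setT x -> 0 <= h x * (g x * g x) by move=> _; rewrite !mule_ge0.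
have h20 x : setT x -> 0 <= 2%:E * (h x * (f x * g x)).
  by move=> _; rewrite !mule_ge0.
rewrite -ge0_integralZl// -!ge0_integralD//.
apply: ge0_ae_eq_integral => //.
- exact: emeasurable_funD.
- exact: emeasurable_funD.
- by move=> x Ax; rewrite adde_ge0// ?hd0 ?h20.
- by move=> x Ax; rewrite adde_ge0// ?hff0 ?hgg0.
apply: filterS2 ff gf => x /fineK fx /fineK gx _.
rewrite (muleCA 2%:E) -!ge0_muleDr ?mule_ge0//; congr (_ * _).
rewrite /sqdist -fx -gx -EFinB abse_EFin -EFin_expe -!EFinM -!EFinD.
by congr (_%:E); rewrite real_normK ?num_real//; ring.
Qed.

Lemma integral_sqdist f g (A B C : R) :
  measurable_fun setT f -> measurable_fun setT g ->
  (forall x, 0 <= f x) -> (forall x, 0 <= g x) ->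
  \int[P]_x (f x * f x) = A%:E -> \int[P]_x (g x * g x) = B%:E ->
  \int[P]_x (f x * g x) = C%:E ->
  \int[P]_x sqdist f g x = (A + B - 2 * C)%:E.
Proof.
move=> mf mg f0 g0 fA gB fgC.
have := @sqdist_weighted (cst 1) f g (@measurable_cst _ _ _ _ _ _) mf mg
  (fun=> lee01) f0 g0.
under eq_integral do rewrite mul1e.
under [X in _ + _ * X]eq_integral do rewrite mul1e.
under [X in _ = X + _]eq_integral do rewrite mul1e.
under [X in _ = _ + X]eq_integral do rewrite mul1e.
have ff : {ae P, forall x, f x \is a fin_num}.
  by apply: square_integrable_ae_fin => //; rewrite fA ltry.
have gf : {ae P, forall x, g x \is a fin_num}.
  by apply: square_integrable_ae_fin => //; rewrite gB ltry.
rewrite fA gB fgC => /(_ ff gf).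
case: (\int[P]_x _) => [r| |]//; rewrite -EFinM -!EFinD => -[rE].
by rewrite -rE addrK.
Qed.

(** The hypothesis on the cross term says that [g] is the orthogonal projection of
    [f] on the line that it spans; the identity is Pythagoras' theorem. *)
Lemma integral_sqdist_proj f g (A B : R) :
  measurable_fun setT f -> measurable_fun setT g ->
  (forall x, 0 <= f x) -> (forall x, 0 <= g x) ->
  \int[P]_x (f x * f x) = A%:E -> \int[P]_x (g x * g x) = B%:E ->
  \int[P]_x (g x * f x) = B%:E ->
  \int[P]_x sqdist f g x = (A - B)%:E.
Proof.
move=> mf mg f0 g0 fA gB gf; rewrite (integral_sqdist mf mg f0 g0 fA gB (C := B)).
  by congr (_%:E); ring.
by rewrite -gf; apply: eq_integral => x _; rewrite muleC.
Qed.

Lemma sqdist_triangle f g k :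
  measurable_fun setT f -> measurable_fun setT g -> measurable_fun setT k ->
  {ae P, forall x, f x \is a fin_num} -> {ae P, forall x, g x \is a fin_num} ->
  {ae P, forall x, k x \is a fin_num} ->
  \int[P]_x sqdist f k x <=
  2%:E * \int[P]_x sqdist f g x + 2%:E * \int[P]_x sqdist g k x.
Proof.
move=> mf mg mk ff gf kf.
rewrite -!ge0_integralZl//; last 4 first.
- exact: measurable_sqdist.
- by move=> x _; exact: sqdist_ge0.
- exact: measurable_sqdist.
- by move=> x _; exact: sqdist_ge0.
rewrite -ge0_integralD//; last 4 first.
- by move=> x _; rewrite mule_ge0// sqdist_ge0.
- by apply: emeasurable_funM => //; exact: measurable_sqdist.
- by move=> x _; rewrite mule_ge0// sqdist_ge0.
- by apply: emeasurable_funM => //; exact: measurable_sqdist.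
apply: ae_ge0_le_integral => //.
- by move=> x _; exact: sqdist_ge0.
- exact: measurable_sqdist.
- by move=> x _; rewrite adde_ge0// mule_ge0// sqdist_ge0.
- by apply: emeasurable_funD; apply: emeasurable_funM => //; exact: measurable_sqdist.
apply: filterS3 ff gf kf => x /fineK fx /fineK gx /fineK kx _.
rewrite /sqdist -fx -gx -kx -!EFinB !abse_EFin -!EFin_expe -!EFinM -!EFinD lee_fin.
rewrite !real_normK ?num_real//.
have := sqr_ge0 ((fine (f x) - fine (g x)) - (fine (g x) - fine (k x))); nra.
Qed.

Lemma sqdist_eq0 f g : measurable_fun setT f -> measurable_fun setT g ->
  {ae P, forall x, f x \is a fin_num} -> {ae P, forall x, g x \is a fin_num} ->
  \int[P]_x sqdist f g x = 0 -> {ae P, forall x, f x = g x}.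
Proof.
move=> mf mg ff gf d0.
have /(ae_eq_integral_abs P measurableT (measurable_sqdist mf mg)) :
    \int[P]_x `|sqdist f g x| = 0.
  by rewrite -d0; apply: eq_integral => x _; rewrite gee0_abs// sqdist_ge0.
move=> d0'; apply: filterS3 ff gf d0' => x /fineK fx /fineK gx /(_ Logic.I) /eqP.
rewrite /sqdist -fx -gx expe_eq0 abse_eq0 -EFinB eqe subr_eq0 => /andP[_].
by move=> /eqP ->.
Qed.

End squared_distance.

(** * A maximal inequality and almost sure convergence *)

Lemma integral_indicM (R : realType) d (Om : measurableType d)
    (mu : measure Om R) (A : set Om) (f : Om -> \bar R) :
  (\int[mu]_x ((\1_A x)%:E * f x) = \int[mu]_(x in A) f x)%E.
Proof.
rewrite [RHS]integral_mkcond epatch_indic.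
by apply: eq_integral => x _; rewrite muleC.
Qed.

Section maximal_inequality.
Local Open Scope ereal_scope.
Context (R : realType) d (Om : measurableType d) (P : probability Om R).
Variables (gens : nat -> set_system Om) (M : nat -> Om -> \bar R) (u : nat -> R).
Hypothesis gens_sub : forall n, <<s gens n>> `<=` measurable.
(** [M] is a martingale for the sigma-algebras generated by [gens].  The martingale
    property [M_orth] is tested against an event of the past times an earlier term,
    the form in which the cascade provides it and in which it acts on squared
    distances. *)
Hypothesis M_adapted : forall k n, (k <= n)%N ->
  measurable_fun (setT : set (g_sigma_algebraType (gens n))) (M k).
Hypothesis M_ge0 : forall n x, 0 <= M n x.
Hypothesis M_orth : forall k n m A, (k <= n)%N -> (n <= m)%N -> <<s gens n>> A ->
  \int[P]_x ((\1_A x)%:E * (M k x * M m x)) = \int[P]_x ((\1_A x)%:E * (M k x * M n x)).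
Hypothesis M_sq : forall n, \int[P]_x (M n x * M n x) = (u n)%:E.

Let mM n : measurable_fun setT (M n).
Proof. by move=> _ A mA; apply: (@gens_sub n); exact: M_adapted. Qed.

Lemma orth_cross_moment k m : (k <= m)%N -> \int[P]_x (M k x * M m x) = (u k)%:E.
Proof.
move=> km; rewrite -M_sq.
have := M_orth (leqnn k) km (@measurableT _ (g_sigma_algebraType (gens k))).
under eq_integral do rewrite indicT mul1e.
by under [in RHS]eq_integral do rewrite indicT mul1e.
Qed.

Lemma orth_ae_fin n : {ae P, forall x, M n x \is a fin_num}.
Proof. by apply: square_integrable_ae_fin => //; rewrite M_sq ltry. Qed.

Lemma orth_sqdist k m : (k <= m)%N -> \int[P]_x sqdist (M m) (M k) x = (u m - u k)%:E.
Proof.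
by move=> km; apply: integral_sqdist_proj => //; exact: orth_cross_moment.
Qed.

(** The squared distance to an earlier term is a submartingale.  Its increment is
    the integral of a square, since the cross terms agree by [M_orth]. *)
Lemma sqdist_submartingale m k n A : (m <= k)%N -> (k <= n)%N -> <<s gens k>> A ->
  \int[P]_x ((\1_A x)%:E * sqdist (M k) (M m) x) <=
  \int[P]_x ((\1_A x)%:E * sqdist (M n) (M m) x).
Proof.
move=> mk kn kA.
have mA : measurable A by exact: gens_sub kA.
have m1 : measurable_fun setT (fun x => (\1_A x)%:E : \bar R).
  by apply/measurable_EFinP; exact: measurable_indic.
have h0 x : 0 <= (\1_A x)%:E :> \bar R by rewrite lee_fin.
pose I f := \int[P]_x ((\1_A x)%:E * f x).
have I0 f : (forall x, 0 <= f x) -> 0 <= I f.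
  by move=> f0; apply: integral_ge0 => x _; rewrite mule_ge0.
have Ifin i j : (i <= j)%N -> I (fun x => M i x * M j x) \is a fin_num.
  move=> ij; rewrite ge0_fin_numE; last by apply: I0 => x; rewrite mule_ge0.
  apply: (@le_lt_trans _ _ (u i)%:E); last by rewrite ltry.
  rewrite -(orth_cross_moment ij); apply: ge0_le_integral => //.
  - by move=> x _; rewrite !mule_ge0.
  - by apply: emeasurable_funM => //; exact: emeasurable_funM.
  - exact: emeasurable_funM.
  - by move=> x _; rewrite gee_pMl// ?mule_ge0// lee_fin indicE; case: (_ \in _).
have E i j : I (sqdist (M i) (M j)) + 2%:E * I (fun x => M i x * M j x) =
    I (fun x => M i x * M i x) + I (fun x => M j x * M j x).
  by apply: sqdist_weighted => //; exact: orth_ae_fin.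
have Ic i j : I (fun x => M i x * M j x) = I (fun x => M j x * M i x).
  by apply: eq_integral => x _; rewrite (muleC (M i x)).
have Ikn : I (fun x => M k x * M n x) = I (fun x => M k x * M k x) by exact: M_orth.
have Imn : I (fun x => M m x * M n x) = I (fun x => M m x * M k x) by exact: M_orth.
have := E n k; have := E n m; have := E k m.
rewrite !(Ic n) (Ic k m) Ikn Imn -/(I _) -/(I (sqdist _ _)).
have := I0 _ (sqdist_ge0 (M n) (M k)).
have := Ifin _ _ mk; have := Ifin _ _ (leqnn k); have := Ifin _ _ (leqnn m).
have := Ifin _ _ (leqnn n).
move: (I (sqdist (M n) (M k))) (I (sqdist (M n) (M m))) (I (sqdist (M k) (M m))).
move: (I (fun x => M n x * M n x)) (I (fun x => M k x * M k x)).
move: (I (fun x => M m x * M m x)) (I (fun x => M m x * M k x)).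
move=> [a| |]// [b| |]// [c| |]// [e| |]// [f| |]// [g| |]// [h| |]// _ _ _ _.
all: rewrite -?EFinM -?EFinD ?lee_fin//.
by move=> f0 [h1] [h2] [h3]; lra.
Qed.

Definition first_passage (l : R) m k : set Om :=
  [set x | l%:E <= sqdist (M (m + k)) (M m) x] `&`
  \bigcap_(j in [set j | (j < k)%N]) [set x | sqdist (M (m + j)) (M m) x < l%:E].

Lemma first_passage_past l m k : <<s gens (m + k)%N>> (first_passage l m k).
Proof.
pose T := g_sigma_algebraType (gens (m + k)%N).
have mD j : (j <= k)%N -> measurable_fun (setT : set T) (sqdist (M (m + j)) (M m)).
  move=> jk; apply: (@measurable_sqdist R _ T).
    by apply: M_adapted; rewrite leq_add2l.
  by apply: M_adapted; rewrite leq_addr.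
apply: (@measurableI _ T).
  by rewrite -[X in _ X]setTI; apply: emeasurable_fun_c_infty => //; exact: mD.
apply: (@bigcap_measurableType _ T) => j /= jk.
rewrite -[X in _ X]setTI; apply: emeasurable_fun_infty_o => //.
by apply: mD; exact: ltnW.
Qed.

Lemma first_passage_disj l m : trivIset setT (first_passage l m).
Proof.
apply/trivIsetP => i j _ _ ij; apply/seteqP; split => // x [[xi xi'] [xj xj']].
by move: ij; rewrite neq_ltn => /orP[ij|ij];
  [have := xj' _ ij|have := xi' _ ij]; rewrite /= ltNge ?xi ?xj.
Qed.

(** On the event of a first passage at time [m + k], the level [l] is at most the
    squared distance at that time, hence in mean at most the one at any later time
    [m + n].  As the events are disjoint, the sum over [k < n] is bounded by the
    mean squared distance between times [m] and [m + n]. *)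
Lemma maximal_inequality (c l : R) m : (0 < l)%R -> (forall n, u n <= c)%R ->
  P (\bigcup_k first_passage l m k) <= ((c - u m) / l)%:E.
Proof.
move=> l0 uc.
have mF k : measurable (first_passage l m k).
  by apply: (@gens_sub (m + k)%N); exact: first_passage_past.
rewrite measure_semi_bigcup//; last 2 first.
- exact: first_passage_disj.
- exact: bigcup_measurable.
apply: lime_le; first by apply: is_cvg_nneseries => n _ _; exact: measure_ge0.
apply: nearW => n.
rewrite EFinM muleC lee_pdivlMl// ge0_sume_distrr//.
apply: (@le_trans _ _ (\sum_(0 <= k < n)
    \int[P]_(x in first_passage l m k) sqdist (M (m + n)) (M m) x)).
  rewrite big_nat_cond [leRHS]big_nat_cond; apply: lee_sum => k /andP[/andP[_ kn] _].
  rewrite -(integral_cst _ (mF k)).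
  apply: (@le_trans _ _ (\int[P]_(x in first_passage l m k) sqdist (M (m + k)) (M m) x)).
    apply: ge0_le_integral => //.
    - by move=> x _; rewrite lee_fin ltW.
    - by apply: measurable_funTS; exact: measurable_sqdist.
    - by move=> x [].
  rewrite -[leLHS]integral_indicM -[leRHS]integral_indicM; apply: sqdist_submartingale.
  - exact: leq_addr.
  - by rewrite leq_add2l ltnW.
  - exact: first_passage_past.
rewrite -ge0_integral_bigsetU//; last 4 first.
- by rewrite iota_uniq.
- exact: sub_trivIset (@first_passage_disj l m).
- by apply: measurable_funTS; exact: measurable_sqdist.
- by move=> x _; exact: sqdist_ge0.
apply: (@le_trans _ _ (\int[P]_x sqdist (M (m + n)) (M m) x)).
  apply: ge0_subset_integral => //.
  - exact: bigsetU_measurable.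
  - exact: measurable_sqdist.
  - by move=> x _; exact: sqdist_ge0.
by rewrite orth_sqdist ?leq_addr// lee_fin lerB.
Qed.

Lemma first_passageN l m x : ~ (\bigcup_k first_passage l m k) x ->
  forall k, sqdist (M (m + k)) (M m) x < l%:E.
Proof.
move=> nF; elim/ltn_ind => k IH; rewrite ltNge; apply/negP => lk.
by apply: nF; exists k => //; split.
Qed.

(** By the maximal inequality the probability that the oscillation after time [m]
    exceeds a given level tends to 0 with [c - u m], so almost every path is a
    Cauchy sequence. *)
Lemma orth_ae_cvg (c : R) : (forall n, u n <= c)%R -> u @ \oo --> c ->
  {ae P, forall x, exists r : R, M n x @[n --> \oo] --> r%:E}.
Proof.
move=> uc ucvg.
pose N l := \bigcap_m \bigcup_k first_passage l.+1%:R^-1 m k.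
have mE l m : measurable (\bigcup_k first_passage l m k).
  apply: bigcup_measurable => k _.
  by apply: (@gens_sub (m + k)%N); exact: first_passage_past.
have aeN l : {ae P, forall x, ~ N l x}.
  have mN : measurable (N l) by exact: bigcapT_measurable.
  have l0 : (0 < l.+1%:R^-1 :> R)%R by rewrite invr_gt0 ltr0n.
  exists (N l); split => //; last by move=> x /=; exact: contrapT.
  have PNE : (fine (P (N l)))%:E = P (N l) by rewrite fineK// fin_num_measure.
  apply/eqP; rewrite eq_le measure_ge0 andbT -PNE lee_fin.
  have cvg0 : ((c - u m) / l.+1%:R^-1)%R @[m --> \oo] --> 0%R.
    rewrite [X in _ --> X](_ : _ = (c - c) / l.+1%:R^-1)%R; last by rewrite subrr mul0r.
    by apply: cvgM; [apply: cvgB => //; exact: cvg_cst|exact: cvg_cst].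
  apply: (@cvgr_to_ge _ _ _ _ _ _ _ cvg0); apply: nearW => m.
  rewrite -lee_fin PNE; apply: (le_trans _ (maximal_inequality m l0 uc)).
  by apply: le_measure; rewrite ?inE//; exact: bigcap_inf.
have := ae_foralln aeN; have := ae_foralln orth_ae_fin.
apply: filterS2 => x Mfin xN.
pose z n := fine (M n x).
have zE n : (z n)%:E = M n x by rewrite /z fineK.
have : cvg (z @ \oo).
  apply/cauchy_cvgP/cauchy_exP => e e0.
  have [l el] : exists l, (l.+1%:R^-1 < e ^+ 2)%R.
    have := @near_infty_natSinv_lt R (PosNum (exprn_gt0 2 e0)).
    by move=> [l _ /(_ l)/= H]; exists l; exact: H.
  have /existsNP[m] : ~ (forall m, (\bigcup_k first_passage l.+1%:R^-1 m k) x).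
    by move=> H; apply: (xN l) => m _; exact: H.
  move=> /first_passageN H; exists (z m).
  exists m => // n /= mn; rewrite /ball /= -(subnKC mn).
  have := H (n - m)%N; rewrite /sqdist -!zE -EFinB abse_EFin -EFin_expe lte_fin.
  move=> /lt_trans/(_ el); rewrite distrC.
  by rewrite ltr_pXn2r// nnegrE// ltW.
move=> /cvg_ex[r zr]; exists r.
by rewrite -(funext zE); apply: cvg_comp zr _.
Qed.

End maximal_inequality.

(** * Moments of the limit *)

Lemma measurable_fun_limn_einf (R : realType) d (T : measurableType d)
    (D : set T) (g : nat -> T -> \bar R) :
  (forall n, measurable_fun D (g n)) ->
  measurable_fun D (fun x => limn_einf (g^~ x)).
Proof.
move=> mg.
rewrite (_ : (fun x => _) = fun x => (- limn_esup (fun n => - g n x))%E).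
  apply: measurableT_comp => //; apply: measurable_fun_limn_esup => n.
  exact: measurableT_comp.
apply/funext => x; rewrite -limn_einfN; congr limn_einf.
by apply/funext => n /=; rewrite oppeK.
Qed.

Section orthogonal_limit.
Local Open Scope ereal_scope.
Context (R : realType) d (Om : measurableType d) (P : probability Om R).

Lemma fatou_ae (g : nat -> Om -> \bar R) (f : Om -> \bar R) (v : nat -> \bar R) V :
  (forall n, measurable_fun setT (g n)) -> measurable_fun setT f ->
  (forall n x, 0 <= g n x) -> (forall x, 0 <= f x) ->
  {ae P, forall x, g n x @[n --> \oo] --> f x} ->
  (forall n, \int[P]_x g n x = v n) -> v @ \oo --> V ->
  \int[P]_x f x <= V.
Proof.
move=> mg mf g0 f0 gf gv vV.
have -> : \int[P]_x f x = \int[P]_x limn_einf (g^~ x).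
  apply: ge0_ae_eq_integral => //.
  - exact: measurable_fun_limn_einf.
  - move=> x _; rewrite limn_einf_lim; apply: lime_ge; first exact: is_cvg_einfs.
    by apply: nearW => n; apply: le_ereal_inf_tmp => _ [k _ <-].
  - apply: filterS gf => x gx _.
    by have [->] := cvg_limn_einf_sup gx.
apply: le_trans (fatou P measurableT mg (fun n x _ => g0 n x)) _.
rewrite (_ : (fun n => _) = v); last exact/funext.
by have [->] := cvg_limn_einf_sup vV.
Qed.

(** The inequality 2 x y <= t x^2 + y^2 / t, integrated; it replaces the
    Cauchy-Schwarz inequality in the identification of the limit. *)
Lemma young_integral (f g : Om -> \bar R) (A B C t : R) : (0 < t)%R ->
  measurable_fun setT f -> measurable_fun setT g ->
  (forall x, 0 <= f x) -> (forall x, 0 <= g x) ->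
  \int[P]_x (f x * f x) = A%:E -> \int[P]_x (g x * g x) = B%:E ->
  \int[P]_x (f x * g x) = C%:E -> (2 * C <= t * A + t^-1 * B)%R.
Proof.
move=> t0 mf mg f0 g0 fA gB fgC.
rewrite -lee_fin EFinD !EFinM -fA -gB -fgC.
have ff : {ae P, forall x, f x \is a fin_num}.
  by apply: square_integrable_ae_fin => //; rewrite fA ltry.
have gf : {ae P, forall x, g x \is a fin_num}.
  by apply: square_integrable_ae_fin => //; rewrite gB ltry.
have mfg := emeasurable_funM mf mg.
have mff := emeasurable_funM mf mf.
have mgg := emeasurable_funM mg mg.
have t0' : (0 <= t)%R := ltW t0.
have tV0 : (0 <= t^-1)%R by rewrite invr_ge0.
have fg0 x : setT x -> 0 <= f x * g x by rewrite mule_ge0.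
have ff0 x : setT x -> 0 <= f x * f x by rewrite mule_ge0.
have gg0 x : setT x -> 0 <= g x * g x by rewrite mule_ge0.
have m1 : measurable_fun setT (fun x => t%:E * (f x * f x)) by exact: emeasurable_funM.
have m2 : measurable_fun setT (fun x => t^-1%:E * (g x * g x)) by exact: emeasurable_funM.
have tff0 x : setT x -> 0 <= t%:E * (f x * f x) by move=> _; rewrite !mule_ge0.
have tgg0 x : setT x -> 0 <= t^-1%:E * (g x * g x).
  by move=> _; rewrite !mule_ge0// lee_fin.
rewrite -!ge0_integralZl// ?lee_fin// -ge0_integralD//.
apply: ae_ge0_le_integral => //.
- by move=> x _; rewrite !mule_ge0.
- exact: emeasurable_funM.
- by move=> x Tx; rewrite adde_ge0// ?tff0 ?tgg0.
- exact: emeasurable_funD.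
apply: filterS2 ff gf => x /fineK fx /fineK gx _.
rewrite -fx -gx -!EFinM -!EFinD lee_fin.
set a := fine _; set b := fine _.
have := sqr_ge0 (t * a - b); have := mulVf (lt0r_neq0 t0).
move: tV0; set r := (t^-1)%R => r0 rt H.
have : (0 <= r * (t * a - b) ^+ 2)%R by rewrite mulr_ge0.
have -> : (r * (t * a - b) ^+ 2 = (r * t) * t * (a * a) - 2 * (r * t) * (a * b) + r * (b * b))%R by ring.
by rewrite rt; lra.
Qed.

Variables (M : nat -> Om -> \bar R) (u : nat -> R) (f : Om -> \bar R) (c : R).
Hypothesis mM : forall n, measurable_fun setT (M n).
Hypothesis mf : measurable_fun setT f.
Hypothesis M0 : forall n x, 0 <= M n x.
Hypothesis f0 : forall x, 0 <= f x.
Hypothesis M_cross : forall k n, (k <= n)%N -> \int[P]_x (M k x * M n x) = (u k)%:E.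
Hypothesis Mf : {ae P, forall x, M n x @[n --> \oo] --> f x}.
Hypothesis f_fin : {ae P, forall x, f x \is a fin_num}.
Hypothesis u_cvg : u @ \oo --> c.

Let M_fin n : {ae P, forall x, M n x \is a fin_num}.
Proof. by apply: square_integrable_ae_fin => //; rewrite M_cross// ltry. Qed.

Let M_dist k n : (k <= n)%N -> \int[P]_x sqdist (M n) (M k) x = (u n - u k)%:E.
Proof.
by move=> kn; apply: integral_sqdist_proj; rewrite ?M_cross.
Qed.

Let sqdist_limit_le n : \int[P]_x sqdist f (M n) x <= (c - u n)%:E.
Proof.
apply: (@fatou_ae (fun m => sqdist (M (m + n)) (M n)) _ (fun m => (u (m + n) - u n)%:E)).
- by move=> m; exact: measurable_sqdist.
- exact: measurable_sqdist.
- by move=> m x; exact: sqdist_ge0.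
- by move=> x; exact: sqdist_ge0.
- apply: filterS3 Mf f_fin (M_fin n) => x Mx fx Mnx.
  have : M (m + n) x - M n x @[m --> \oo] --> f x - M n x.
    apply: cvgeB; [by rewrite fin_num_adde_defr|by rewrite (cvg_shiftn n (M ^~ x))|exact: cvg_cst].
  move=> /cvg_abse H; rewrite /sqdist expe2.
  rewrite (_ : (fun m => _) = fun m => `|M (m + n) x - M n x| * `|M (m + n) x - M n x|).
    by apply: cvgeM => //; rewrite mule_def_fin// abse_fin_num fin_numB fx.
  by apply/funext => m; rewrite expe2.
- by move=> m; rewrite M_dist// leq_addl.
- apply: cvg_EFin; first by apply: nearW.
  by apply: cvgB; [rewrite (cvg_shiftn n u)|exact: cvg_cst].
Qed.

Let cross_limit_le n : \int[P]_x (f x * M n x) <= (u n)%:E.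
Proof.
apply: (@fatou_ae (fun m x => M (m + n) x * M n x) _ (fun m => (u n)%:E)).
- by move=> m; exact: emeasurable_funM.
- exact: emeasurable_funM.
- by move=> m x; rewrite mule_ge0.
- by move=> x; rewrite mule_ge0.
- apply: filterS3 Mf f_fin (M_fin n) => x Mx fx Mnx.
  apply: cvgeM; [by rewrite mule_def_fin|by rewrite (cvg_shiftn n (M ^~ x))|exact: cvg_cst].
- by move=> m; rewrite -(M_cross (leq_addl m n)); under eq_integral do rewrite muleC.
- exact: cvg_cst.
Qed.

Let square_limit_le : \int[P]_x (f x * f x) <= c%:E.
Proof.
apply: (@fatou_ae (fun m x => M m x * M m x) _ (fun m => (u m)%:E)).
- by move=> m; exact: emeasurable_funM.
- exact: emeasurable_funM.
- by move=> m x; rewrite mule_ge0.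
- by move=> x; rewrite mule_ge0.
- apply: filterS2 Mf f_fin => x Mx fx.
  by apply: cvgeM => //; rewrite mule_def_fin.
- by move=> m; rewrite M_cross.
- by apply: cvg_EFin => //; exact: nearW.
Qed.

(** Fatou's lemma bounds E f^2, E (f M_n) and E (f - M_n)^2 from above by [c],
    [u n] and [c - u n].  The last bound tends to 0, so mass cannot be lost: with
    the inequality of Young it yields E f^2 >= u n / t - (c - u n) / (t - 1) for
    every t > 1, hence E f^2 = c, and expanding E (f - M_n)^2 gives the rest. *)
Lemma orth_limit : [/\ \int[P]_x (f x * f x) = c%:E,
  forall n, \int[P]_x (f x * M n x) = (u n)%:E &
  forall n, \int[P]_x sqdist f (M n) x = (c - u n)%:E].
Proof.
have nonneg_fin (r : \bar R) (v : R) : 0 <= r -> r <= v%:E -> r = (fine r)%:E.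
  by move=> r0 rv; rewrite fineK// ge0_fin_numE// (le_lt_trans rv)// ltry.
have f2E : \int[P]_x (f x * f x) = (fine (\int[P]_x (f x * f x)))%:E.
  by apply: nonneg_fin square_limit_le; apply: integral_ge0 => x _; rewrite mule_ge0.
have fME n : \int[P]_x (f x * M n x) = (fine (\int[P]_x (f x * M n x)))%:E.
  by apply: nonneg_fin (cross_limit_le n); apply: integral_ge0 => x _; rewrite mule_ge0.
move: f2E fME; set A := fine _; move=> fA fC.
pose C n := fine (\int[P]_x (f x * M n x)).
have dE n : \int[P]_x sqdist f (M n) x = (A + u n - 2 * C n)%:E.
  by apply: integral_sqdist => //; rewrite M_cross.
have A0 : (0 <= A)%R.
  by rewrite -lee_fin -fA; apply: integral_ge0 => x _; rewrite mule_ge0.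
have Ac : (A <= c)%R by rewrite -lee_fin -fA.
have Cu n : (C n <= u n)%R by rewrite -lee_fin -fC.
have dle n : (A + u n - 2 * C n <= c - u n)%R by rewrite -lee_fin -dE.
have young n t : (0 < t)%R -> (2 * C n <= t * A + t^-1 * u n)%R.
  by move=> t0; apply: (young_integral t0 mf (mM n)) => //; rewrite M_cross.
have cA : (c <= A)%R.
  rewrite leNgt; apply/negP => Alt.
  pose t := (2 * c / (A + c))%R.
  have Ac0 : (0 < A + c)%R by lra.
  have t1 : (1 < t)%R by rewrite /t ltr_pdivlMr//; lra.
  have t0 : (0 < t)%R by lra.
  have key n : (t^-1 * u n - A <= (c - u n) / (t - 1))%R.
    rewrite ler_pdivlMr; last by lra.
    have := young n t t0; have := dle n => H1 H2.
    have tV : (t^-1 * t = 1)%R by rewrite mulVf// gt_eqF.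
    move: H2 tV; set r := (t^-1)%R => H2 tV.
    have -> : ((r * u n - A) * (t - 1) = (r * t) * u n - r * u n - A * t + A)%R by ring.
    by rewrite tV; lra.
  have lim1 : (t^-1 * u n - A)%R @[n --> \oo] --> (t^-1 * c - A)%R.
    by apply: cvgB; [apply: cvgM => //; exact: cvg_cst|exact: cvg_cst].
  have lim2 : ((c - u n) / (t - 1))%R @[n --> \oo] --> ((c - c) / (t - 1))%R.
    by apply: cvgM; [apply: cvgB => //; exact: cvg_cst|exact: cvg_cst].
  have : (t^-1 * c - A <= (c - c) / (t - 1))%R.
    by apply: ler_cvg_to lim1 lim2 _; exact: nearW.
  rewrite subrr mul0r subr_le0 /t invf_div.
  have c0 : (c != 0)%R by rewrite gt_eqF//; lra.
  have -> : ((A + c) / (2 * c) * c = (A + c) / 2)%R.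
    by rewrite invfM -!mulrA mulVf// mulr1.
  by lra.
have AE : A = c by apply/eqP; rewrite eq_le Ac cA.
have CE n : C n = u n.
  by apply/eqP; rewrite eq_le Cu/=; have := dle n; rewrite AE; lra.
split; first by rewrite fA AE.
- by move=> n; rewrite fC -/(C n) CE.
- by move=> n; rewrite dE AE CE; congr (_%:E); ring.
Qed.

End orthogonal_limit.

(** * The recursion of second moments *)

Section second_moment_recursion.
Context (R : realType) (s o : R).

Fixpoint second_moment n : R :=
  if n is k.+1 then s * second_moment k ^+ 2 + o else 1.

Variable alpha : R.
Hypothesis s_ge0 : 0 <= s.
Hypotheses (alpha_ge1 : 1 <= alpha) (alpha_fix : s * alpha ^+ 2 + o = alpha).
Hypothesis alpha_small : 2 * s * alpha <= 1.

(** The map x |-> s x^2 + o is increasing on the non-negative reals and fixes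
    alpha; it does not decrease 1 because 1 lies below its smaller fixed point. *)
Lemma second_moment_bounds n : 1 <= second_moment n <= alpha.
Proof.
elim: n => [|n /andP[l h]] /=; first by rewrite lexx.
have h2 : second_moment n ^+ 2 <= alpha ^+ 2 by rewrite ler_pXn2r ?nnegrE//; lra.
have l2 : 1 <= second_moment n ^+ 2 by rewrite exprn_ege1.
have sh : s * second_moment n ^+ 2 <= s * alpha ^+ 2 by rewrite ler_wpM2l.
have sl : s <= s * second_moment n ^+ 2 by rewrite ler_peMr.
have so : 1 <= s + o.
  have : 0 <= (alpha - 1) * (1 - s * (alpha + 1)).
    apply: mulr_ge0; first lra.
    have : 0 <= s * (alpha - 1) by rewrite mulr_ge0// subr_ge0.
    by move: alpha_small; nra.
  have oE : o = alpha - s * alpha ^+ 2 by apply/eqP; rewrite eq_sym subr_eq addrC alpha_fix.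
  rewrite -[_ <= s + o]subr_ge0 oE.
  by congr (0 <= _); ring.
by rewrite (le_trans so) ?lerD2r//= -[leRHS]alpha_fix lerD2r.
Qed.

Lemma second_moment_le_alpha n : second_moment n <= alpha.
Proof. by have /andP[] := second_moment_bounds n. Qed.

Lemma second_moment_nondecreasing : {homo second_moment : n m / (n <= m)%N >-> n <= m}.
Proof.
apply/nondecreasing_seqP => n /=.
have /andP[l h] := second_moment_bounds n.
have : 0 <= (alpha - second_moment n) * (1 - s * (alpha + second_moment n)).
  apply: mulr_ge0; first lra.
  have : 0 <= s * (alpha - second_moment n) by rewrite mulr_ge0// subr_ge0.
  by move: alpha_small; nra.
have oE : o = alpha - s * alpha ^+ 2 by apply/eqP; rewrite eq_sym subr_eq addrC alpha_fix.
rewrite -[second_moment n <= _]subr_ge0 oE.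
by congr (0 <= _); ring.
Qed.

(** The monotone limit is a fixed point in [1, alpha], and the condition on [alpha]
    excludes a fixed point strictly below it. *)
Lemma second_moment_cvg : second_moment @ \oo --> alpha.
Proof.
have : cvgn second_moment.
  apply: nondecreasing_is_cvgn; first exact: second_moment_nondecreasing.
  by exists alpha => _ [n _ <-]; exact: second_moment_le_alpha.
move=> cu; pose l : R := limn second_moment.
have ul : second_moment @ \oo --> l by exact: cu.
have l1 : 1 <= l.
  apply: (@cvgr_to_ge _ _ _ _ _ _ _ ul); apply: nearW => n.
  by have /andP[] := second_moment_bounds n.
have la : l <= alpha.
  apply: (@cvgr_to_le _ _ _ _ _ _ _ ul); apply: nearW => n.
  exact: second_moment_le_alpha.
have lfix : s * l ^+ 2 + o = l.
  apply: (@cvg_unique _ (@Rhausdorff R) (second_moment \o S @ \oo)).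
    have : s * second_moment n ^+ 2 + o @[n --> \oo] --> s * l ^+ 2 + o.
      apply: cvgD; last exact: cvg_cst.
      by apply: cvgM; [exact: cvg_cst|under eq_fun do rewrite expr2; rewrite expr2; exact: cvgM].
    by apply: cvg_trans.
  by rewrite -(cvg_shiftS second_moment) in ul.
suff <- : l = alpha by [].
apply/eqP; rewrite eq_le la /= leNgt; apply/negP => lt.
have al0 : 0 < alpha - l by rewrite subr_gt0.
have : (alpha - l) * (s * (alpha + l) - 1) = 0.
  rewrite (_ : _ * _ = (s * alpha ^+ 2 + o - alpha) - (s * l ^+ 2 + o - l)); last ring.
  by rewrite alpha_fix lfix !subrr.
move/eqP; rewrite mulf_eq0 gt_eqF//= subr_eq0 => /eqP s1.
have s0 : 0 < s.
  rewrite lt_neqAle s_ge0 andbT; apply/eqP => s0.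
  by move: s1; rewrite -s0 mul0r => /esym/eqP; rewrite oner_eq0.
have : 0 < s * (alpha - l) by rewrite mulr_gt0.
by rewrite (_ : _ * _ = 2 * s * alpha - s * (alpha + l)); [rewrite s1 subr_gt0 ltNge alpha_small|ring].
Qed.

End second_moment_recursion.

(** * The limit of the cascade and its fixed point equation *)

Section cascade_limit.
Local Open Scope ereal_scope.
Context (R : realType).

(** The upper limit is measurable on every path; almost surely it is a limit. *)
Definition cascade_limit s (p : pathspace word (Rseq R)) : \bar R :=
  limn_esup (fun n => cascade n s p).

Lemma limn_esup_ge0 (v : nat -> \bar R) : (forall n, 0 <= v n) -> 0 <= limn_esup v.
Proof.
move=> v0; rewrite limn_esup_lim; apply: lime_ge; first exact: is_cvg_esups.
apply: nearW => n; apply: le_trans (v0 n) _; apply: ereal_sup_ubound.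
by exists n => //=.
Qed.

Lemma cascade_limit_ge0 s p : 0 <= cascade_limit s p.
Proof. by apply: limn_esup_ge0 => n; exact: cascade_ge0. Qed.

Lemma measurable_cascade_limit s : measurable_fun setT (cascade_limit s).
Proof. by apply: measurable_fun_limn_esup => n; exact: measurable_cascade. Qed.

Lemma cascade_limit_shift s t p :
  cascade_limit (s ++ t) p = cascade_limit t (fun u => p (s ++ u)).
Proof. by congr limn_esup; apply/funext => n; exact: cascade_shift. Qed.

Context d0 (Om0 : measurableType d0) (P0 : probability Om0 R).
Variable a0 : {RV P0 >-> Rseq R}.
Context d (Om : measurableType d) (P : probability Om R).
Variable X : word -> {RV P >-> Rseq R}.
Hypothesis X_iid : iid_family setT X (distribution P0 a0).
Hypothesis a0_mean : \int[P0]_y total (a0 y) = 1.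
Variables s2 o2 alpha : R.
Hypotheses (s2E : diag_moment a0 = s2%:E) (o2E : offdiag_moment a0 = o2%:E).
Hypothesis s2_ge0 : (0 <= s2)%R.
Hypotheses (alpha_ge1 : (1 <= alpha)%R).
Hypothesis alpha_fix : (s2 * alpha ^+ 2 + o2 = alpha)%R.
Hypothesis alpha_small : (2 * s2 * alpha <= 1)%R.

Let indepX : independent_family setT X := X_iid.1.
Local Notation Zr := (Zr X).
Local Notation sm := (second_moment s2 o2).

Lemma children_product s j (f g : Om -> \bar R) :
  depends_on X (subtree (rcons s (j, false))) f ->
  depends_on X (subtree (rcons s (j, true))) g ->
  (forall x, 0 <= f x) -> (forall x, 0 <= g x) ->
  \int[P]_x (f x * g x) = (\int[P]_x f x) * (\int[P]_x g x).
Proof.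
move=> Df Dg; apply: (expectation_disjoint indepX _ Df Dg).
by apply: subtree_rcons_disj; rewrite xpair_eqE andbF.
Qed.

Lemma children_depends s j (f g : Om -> \bar R) :
  depends_on X (subtree (rcons s (j, false))) f ->
  depends_on X (subtree (rcons s (j, true))) g ->
  depends_on X (children s j) (fun x => f x * g x).
Proof.
move=> Df Dg; apply: depends_on_mul.
  by apply: depends_on_sub Df; exact: subsetUl.
by apply: depends_on_sub Dg; exact: subsetUr.
Qed.

(** The form in which the second moment formula serves below: the cascade, its limit
    and the partial iterates are all sums of products of one variable below each of
    the two children of an index. *)
Lemma branching_pair_moment s (f0 f1 g0 g1 : nat -> Om -> \bar R) (c0 c1 : R) :
  (forall j, depends_on X (subtree (rcons s (j, false))) (f0 j)) ->
  (forall j, depends_on X (subtree (rcons s (j, true))) (f1 j)) ->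
  (forall j, depends_on X (subtree (rcons s (j, false))) (g0 j)) ->
  (forall j, depends_on X (subtree (rcons s (j, true))) (g1 j)) ->
  (forall j x, 0 <= f0 j x) -> (forall j x, 0 <= f1 j x) ->
  (forall j x, 0 <= g0 j x) -> (forall j x, 0 <= g1 j x) ->
  (forall j, \int[P]_x f0 j x = 1) -> (forall j, \int[P]_x f1 j x = 1) ->
  (forall j, \int[P]_x g0 j x = 1) -> (forall j, \int[P]_x g1 j x = 1) ->
  (forall j, \int[P]_x (f0 j x * g0 j x) = c0%:E) ->
  (forall j, \int[P]_x (f1 j x * g1 j x) = c1%:E) ->
  \int[P]_x (branching X s (fun j y => f0 j y * f1 j y) x *
             branching X s (fun j y => g0 j y * g1 j y) x) =
  (s2 * (c0 * c1) + o2)%:E.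
Proof.
move=> Df0 Df1 Dg0 Dg1 pf0 pf1 pg0 pg1 Ef0 Ef1 Eg0 Eg1 E0 E1.
rewrite (branching_second_moment X_iid (D := children s) (c := (c0 * c1)%:E)).
- by rewrite s2E o2E -EFinM -EFinD.
- exact: children_notin.
- exact: children_disj.
- by move=> j; exact: children_depends.
- by move=> j; exact: children_depends.
- by move=> j x; rewrite mule_ge0.
- by move=> j x; rewrite mule_ge0.
- by move=> j; rewrite (children_product (Df0 j) (Df1 j))// Ef0 Ef1 mul1e.
- by move=> j; rewrite (children_product (Dg0 j) (Dg1 j))// Eg0 Eg1 mul1e.
- move=> j; rewrite EFinM -(E0 j) -(E1 j) -(children_product (s := s) (j := j)).
  + by apply: eq_integral => x _; rewrite muleACA.
  + by apply: depends_on_mul.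
  + by apply: depends_on_mul.
  + by move=> x; rewrite mule_ge0.
  + by move=> x; rewrite mule_ge0.
Qed.

Lemma Zr_square n s : \int[P]_x (Zr n s x * Zr n s x) = (sm n)%:E.
Proof.
elim: n s => [|n IH] s.
  rewrite (eq_integral (cst 1)) => [|x _]; last by rewrite mule1.
  by rewrite integral_cst// mul1e; exact: probability_setT.
rewrite (eq_integral (fun x => branching X s (fun j y => Zr n (rcons s (j, false)) y *
    Zr n (rcons s (j, true)) y) x * branching X s (fun j y => Zr n (rcons s (j, false)) y *
    Zr n (rcons s (j, true)) y) x)); last by move=> x _; rewrite ZrS.
rewrite (branching_pair_moment (c0 := sm n) (c1 := sm n)) /= ?expr2//.
all: by move=> *; first [exact: Zr_depends_subtree|exact: Zr_ge0|exact: (Zr_mean X_iid)].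
Qed.

(** The filtration seen from [s] contains everything outside the subtree of [s]
    from the start. *)
Definition past s n : set word := [set t | ~ (prefix s t /\ (size s + n <= size t)%N)].

Lemma Zr_orth s k n m A : (k <= n)%N -> (n <= m)%N ->
  <<s family_gens X (past s n) >> A ->
  \int[P]_x ((\1_A x)%:E * (Zr k s x * Zr m s x)) =
  \int[P]_x ((\1_A x)%:E * (Zr k s x * Zr n s x)).
Proof.
move=> kn nm pA; under eq_integral do rewrite muleA.
rewrite (martingale_le X_iid a0_mean nm).
- by under eq_integral do rewrite -muleA.
- by apply: depends_on_mul; [exact: depends_on_indic|exact: Zr_past].
- by move=> x; rewrite mule_ge0// ?Zr_ge0// lee_fin.
Qed.

Let gens_sub s n : <<s family_gens X (past s n) >> `<=` measurable.
Proof. exact: family_sigma_measurable. Qed.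

Let Zr_adapted s k n : (k <= n)%N -> measurable_fun
  (setT : set (g_sigma_algebraType (family_gens X (past s n)))) (Zr k s).
Proof. exact: Zr_past. Qed.

Lemma Zr_cross s k n : (k <= n)%N -> \int[P]_x (Zr k s x * Zr n s x) = (sm k)%:E.
Proof.
exact: (@orth_cross_moment R _ _ P (fun n => family_gens X (past s n))
  (fun n => Zr n s) sm (@Zr_orth s) (fun n => Zr_square n s)).
Qed.

Definition Zlim s (x : Om) : \bar R := cascade_limit s (random_path X x).

Lemma Zlim_ge0 s x : 0 <= Zlim s x. Proof. exact: cascade_limit_ge0. Qed.

Lemma Zlim_depends s : depends_on X (subtree s) (Zlim s).
Proof.
apply: (@measurable_fun_limn_esup _ (g_sigma_algebraType (family_gens X (subtree s)))) => n.
exact: Zr_depends_subtree.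
Qed.

Lemma Zlim_measurable s : measurable_fun setT (Zlim s).
Proof. exact: depends_on_measurable (@Zlim_depends s). Qed.

Lemma Zlim_cvg s : {ae P, forall x,
  Zlim s x \is a fin_num /\ Zr n s x @[n --> \oo] --> Zlim s x}.
Proof.
have := @orth_ae_cvg R _ _ P (fun n => family_gens X (past s n)) (fun n => Zr n s) sm
  (@gens_sub s) (@Zr_adapted s) (fun n x => Zr_ge0 X n s x)
  (@Zr_orth s) (fun n => Zr_square n s) alpha
  (second_moment_le_alpha s2_ge0 alpha_ge1 alpha_fix alpha_small)
  (second_moment_cvg s2_ge0 alpha_ge1 alpha_fix alpha_small).
apply: filterS => x [r xr].
have -> : Zlim s x = r%:E.
  by rewrite /Zlim /cascade_limit; have [_ ->] := cvg_limn_einf_sup xr.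
by [].
Qed.

Let Zlim_orth s := @orth_limit R _ _ P (fun n => Zr n s) sm (Zlim s) alpha
  (fun n => Zr_measurable X n s) (@Zlim_measurable s) (fun n x => Zr_ge0 X n s x)
  (@Zlim_ge0 s) (@Zr_cross s).

Lemma Zlim_fin s : {ae P, forall x, Zlim s x \is a fin_num}.
Proof. by apply: filterS (Zlim_cvg s) => x []. Qed.

Lemma Zlim_moments s : [/\ \int[P]_x (Zlim s x * Zlim s x) = alpha%:E,
  forall n, \int[P]_x (Zlim s x * Zr n s x) = (sm n)%:E &
  forall n, \int[P]_x sqdist (Zlim s) (Zr n s) x = (alpha - sm n)%:E].
Proof.
apply: Zlim_orth.
- by apply: filterS (Zlim_cvg s) => x [].
- exact: Zlim_fin.
- exact: (second_moment_cvg s2_ge0 alpha_ge1 alpha_fix alpha_small).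
Qed.

Lemma Zlim_mean s : \int[P]_x Zlim s x = 1.
Proof.
have [_ /(_ 0%N) <- _] := Zlim_moments s.
by apply: eq_integral => x _; rewrite /= mule1.
Qed.

Lemma Zlim_square s : \int[P]_x (Zlim s x * Zlim s x) = alpha%:E.
Proof. by have [] := Zlim_moments s. Qed.

Lemma Zlim_cross s n : \int[P]_x (Zr n s x * Zlim s x) = (sm n)%:E.
Proof.
by have [_ <- _] := Zlim_moments s; apply: eq_integral => x _; rewrite muleC.
Qed.

Definition Zchildren s j (x : Om) : \bar R :=
  Zlim (rcons s (j, false)) x * Zlim (rcons s (j, true)) x.

Lemma Zchildren_ge0 s j x : 0 <= Zchildren s j x.
Proof. by rewrite mule_ge0// Zlim_ge0. Qed.

Lemma branching_measurable s (f : nat -> Om -> \bar R) :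
  (forall j x, 0 <= f j x) -> (forall j, measurable_fun setT (f j)) ->
  measurable_fun setT (branching X s f).
Proof.
move=> f0 mf; apply: ge0_emeasurable_sum => [j x _ _|j _].
  by rewrite mule_ge0// weight_ge0.
by apply: emeasurable_funM => //; exact: measurable_weight_RV.
Qed.

Lemma Zchildren_measurable s j : measurable_fun setT (Zchildren s j).
Proof. by apply: emeasurable_funM; exact: Zlim_measurable. Qed.

(** The right-hand side S has second moment s alpha^2 + o = alpha, and
    E (Z_(n+1) S) = s (E Z_n^2)^2 + o = E Z_(n+1)^2.  So E (Z_(n+1) - S)^2 and
    E (Z - Z_(n+1))^2 are both alpha - E Z_(n+1)^2, which tends to 0. *)
Lemma Zlim_fixed_point s :
  {ae P, forall x, Zlim s x = branching X s (Zchildren s) x}.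
Proof.
have mS : measurable_fun setT (branching X s (Zchildren s)).
  by apply: branching_measurable => j; [exact: Zchildren_ge0|exact: Zchildren_measurable].
have S0 x : 0 <= branching X s (Zchildren s) x.
  by apply: branching_ge0 => j y; exact: Zchildren_ge0.
have ES : \int[P]_x (branching X s (Zchildren s) x * branching X s (Zchildren s) x) =
    alpha%:E.
  by rewrite (branching_pair_moment (c0 := alpha) (c1 := alpha)) -?expr2 ?alpha_fix//;
    move=> *; first [exact: Zlim_depends|exact: Zlim_ge0|exact: Zlim_mean|exact: Zlim_square].
have EZS n : \int[P]_x (Zr n.+1 s x * branching X s (Zchildren s) x) = (sm n.+1)%:E.
  rewrite (eq_integral (fun x => branching X s (fun j y => Zr n (rcons s (j, false)) y *
    Zr n (rcons s (j, true)) y) x * branching X s (Zchildren s) x)); last first.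
    by move=> x _; rewrite ZrS.
  by rewrite (branching_pair_moment (c0 := sm n) (c1 := sm n)) -?expr2//;
    move=> *; first [exact: Zlim_depends|exact: Zlim_ge0|exact: Zlim_mean|
    exact: Zr_depends_subtree|exact: Zr_ge0|exact: (Zr_mean X_iid)|exact: Zlim_cross].
have S_fin : {ae P, forall x, branching X s (Zchildren s) x \is a fin_num}.
  by apply: square_integrable_ae_fin => //; rewrite ES ltry.
have dS n : \int[P]_x sqdist (Zr n.+1 s) (branching X s (Zchildren s)) x =
    (alpha - sm n.+1)%:E.
  rewrite (integral_sqdist (A := sm n.+1) (B := alpha) (C := sm n.+1))//.
  - by congr (_%:E); ring.
  - exact: Zr_measurable.
  - by move=> x; exact: Zr_ge0.
  - exact: Zr_square.
have Zr_fin n : {ae P, forall x, Zr n s x \is a fin_num}.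
  apply: square_integrable_ae_fin; [exact: Zr_measurable|exact: Zr_ge0|].
  by rewrite Zr_square ltry.
apply: (sqdist_eq0 (@Zlim_measurable s) mS (Zlim_fin s) S_fin).
have dle n : \int[P]_x sqdist (Zlim s) (branching X s (Zchildren s)) x <=
    (4 * (alpha - sm n.+1))%:E.
  apply: le_trans (sqdist_triangle (@Zlim_measurable s) (@Zr_measurable _ _ _ _ X n.+1 s) mS
    (Zlim_fin s) (Zr_fin n.+1) S_fin) _.
  have [_ _ ->] := Zlim_moments s; rewrite dS -!EFinM -EFinD lee_fin.
  by rewrite le_eqVlt; apply/orP; left; apply/eqP; ring.
apply/eqP; rewrite eq_le; apply/andP; split; last first.
  by apply: integral_ge0 => x _; exact: sqdist_ge0.
have lim0 : (4 * (alpha - sm n.+1))%:E @[n --> \oo] --> (4 * (alpha - alpha))%:E.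
  apply: cvg_EFin; first exact: nearW.
  apply: cvgM; first exact: cvg_cst; apply: cvgB; first exact: cvg_cst.
  have := second_moment_cvg s2_ge0 alpha_ge1 alpha_fix alpha_small.
  by rewrite -(cvg_shiftS sm).
rewrite subrr mulr0 in lim0.
by apply: (cvge_to_ge lim0); exact: nearW.
Qed.

(** The common value of E Y_n^2 and E (Y_n Z). *)
Fixpoint cross_moment n : R := if n is k.+1 then s2 * (cross_moment k * alpha) + o2 else 1.

(** The fixed point equation iterated [n] times along the children marked [false],
    with the innermost factor replaced by its mean 1. *)
Fixpoint Yr n (s : word) : Om -> \bar R :=
  if n is k.+1 then
    branching X s (fun j y => Yr k (rcons s (j, false)) y * Zlim (rcons s (j, true)) y)
  else cst 1.

Lemma Yr_ge0 n s x : 0 <= Yr n s x.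
Proof.
elim: n s x => [|n IH] s x; first exact: lee01.
by apply: branching_ge0 => j y; rewrite mule_ge0// Zlim_ge0.
Qed.

Lemma Yr_depends n s : depends_on X (subtree s) (Yr n s).
Proof.
elim: n s => [|n IH] s; first exact: depends_on_cst.
apply: branching_depends => [j x||j].
- by rewrite mule_ge0 ?Yr_ge0 ?Zlim_ge0.
- exact: subtree_refl.
- apply: depends_on_mul.
    by apply: depends_on_sub (IH _); exact: subtree_rcons.
  by apply: depends_on_sub (@Zlim_depends _); exact: subtree_rcons.
Qed.

Lemma Yr_measurable n s : measurable_fun setT (Yr n s).
Proof. exact: depends_on_measurable (@Yr_depends n s). Qed.

Lemma Yr_mean n s : \int[P]_x Yr n s x = 1.
Proof.
elim: n s => [|n IH] s /=.
  by rewrite integral_cst// mul1e; exact: probability_setT.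
rewrite (branching_mean X_iid (D := children s)) ?a0_mean//.
- exact: children_notin.
- by move=> j; apply: children_depends; [exact: Yr_depends|exact: Zlim_depends].
- by move=> j x; rewrite mule_ge0 ?Yr_ge0 ?Zlim_ge0.
- move=> j; rewrite (children_product (@Yr_depends _ _) (@Zlim_depends _)).
  + by rewrite IH Zlim_mean mule1.
  + exact: Yr_ge0.
  + exact: Zlim_ge0.
Qed.

Lemma Yr_square n s : \int[P]_x (Yr n s x * Yr n s x) = (cross_moment n)%:E.
Proof.
elim: n s => [|n IH] s.
  rewrite (eq_integral (cst 1)) => [|x _]; last by rewrite mule1.
  by rewrite integral_cst// mul1e; exact: probability_setT.
by rewrite /= (branching_pair_moment (c0 := cross_moment n) (c1 := alpha))//;
  move=> *; first [exact: Yr_depends|exact: Zlim_depends|exact: Yr_ge0|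
    exact: Zlim_ge0|exact: Yr_mean|exact: Zlim_mean|exact: Zlim_square].
Qed.

(** Both factors are branching sums over the children of [s], by the fixed point
    equation for the limit, so the second moment formula applies again. *)
Lemma Yr_Zlim n s : \int[P]_x (Yr n s x * Zlim s x) = (cross_moment n)%:E.
Proof.
elim: n s => [|n IH] s.
  rewrite -[RHS](Zlim_mean s).
  by apply: eq_integral => x _; rewrite mul1e.
transitivity (\int[P]_x (Yr n.+1 s x * branching X s (Zchildren s) x)).
  apply: ge0_ae_eq_integral => //.
  - by apply: emeasurable_funM; [exact: Yr_measurable|exact: Zlim_measurable].
  - apply: emeasurable_funM; first exact: Yr_measurable.
    by apply: branching_measurable => j; [exact: Zchildren_ge0|exact: Zchildren_measurable].
  - by move=> x _; rewrite mule_ge0 ?Yr_ge0 ?Zlim_ge0.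
  - move=> x _; rewrite mule_ge0 ?Yr_ge0//.
    by apply: branching_ge0 => j y; exact: Zchildren_ge0.
  - by apply: filterS (Zlim_fixed_point s) => x -> _.
by rewrite /= (branching_pair_moment (c0 := cross_moment n) (c1 := alpha))//;
  move=> *; first [exact: Yr_depends|exact: Zlim_depends|exact: Yr_ge0|
    exact: Zlim_ge0|exact: Yr_mean|exact: Zlim_mean|exact: Zlim_square].
Qed.

Lemma Yr_fin n s : {ae P, forall x, Yr n s x \is a fin_num}.
Proof.
apply: square_integrable_ae_fin; [exact: Yr_measurable|exact: Yr_ge0|].
by rewrite Yr_square ltry.
Qed.

Lemma Yr_sqdist n s : \int[P]_x sqdist (Zlim s) (Yr n s) x = (alpha - cross_moment n)%:E.
Proof.
apply: integral_sqdist_proj.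
- exact: Zlim_measurable.
- exact: Yr_measurable.
- exact: Zlim_ge0.
- exact: Yr_ge0.
- exact: Zlim_square.
- exact: Yr_square.
- exact: Yr_Zlim.
Qed.

Lemma cross_moment_gap n : (alpha - cross_moment n.+1 = s2 * alpha * (alpha - cross_moment n))%R.
Proof. by rewrite /= -{1}alpha_fix; ring. Qed.

Lemma cross_moment_le n : (0 <= alpha - cross_moment n)%R.
Proof.
elim: n => [|n IH]; first by rewrite subr_ge0.
by rewrite cross_moment_gap mulr_ge0// mulr_ge0// (le_trans ler01).
Qed.

(** The remainder [2 * (alpha - cross_moment n)] dominates the rest of the geometric
    series of ratio [s2 * alpha <= 1 / 2] and makes the bound inductive. *)
Lemma cross_moment_sum n : (\sum_(0 <= k < n) (alpha - cross_moment k)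
  + 2 * (alpha - cross_moment n) <= 2 * (alpha - 1))%R.
Proof.
elim: n => [|n IH]; first by rewrite big_geq// add0r.
apply: le_trans IH; rewrite big_nat_recr//= -addrA lerD2l cross_moment_gap.
have := ler_wpM2r (cross_moment_le n) alpha_small.
rewrite mul1r => h.
rewrite [X in (_ <= X)%R]mulrDl mul1r lerD2l.
by rewrite !mulrA.
Qed.

(** The squared distances are summable in mean, hence almost surely, hence tend to
    0 almost surely. *)
Lemma Yr_cvg s : {ae P, forall x, Yr n s x @[n --> \oo] --> Zlim s x}.
Proof.
have md n : measurable_fun setT (sqdist (Zlim s) (Yr n s)).
  by apply: measurable_sqdist; [exact: Zlim_measurable|exact: Yr_measurable].
have sum_fin : \int[P]_x \sum_(0 <= n <oo) sqdist (Zlim s) (Yr n s) x < +oo.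
  rewrite integral_nneseries//; last by move=> n x _; exact: sqdist_ge0.
  apply: (@le_lt_trans _ _ (2 * (alpha - 1))%:E); last by rewrite ltry.
  apply: lime_le.
    by apply: is_cvg_nneseries => n _ _; apply: integral_ge0 => x _; exact: sqdist_ge0.
  apply: nearW => n; under eq_bigr do rewrite Yr_sqdist.
  rewrite sumEFin lee_fin; apply: le_trans (cross_moment_sum n).
  by rewrite lerDl mulr_ge0// cross_moment_le.
have m_sum : measurable_fun setT (fun x => \sum_(0 <= n <oo) sqdist (Zlim s) (Yr n s) x).
  by apply: ge0_emeasurable_sum => // k x _ _; exact: sqdist_ge0.
have sum0 x : 0 <= \sum_(0 <= n <oo) sqdist (Zlim s) (Yr n s) x.
  by apply: nneseries_ge0 => n _ _; exact: sqdist_ge0.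
have aeY := ae_foralln (fun n => Yr_fin n s).
apply: filterS3 (ge0_ae_fin m_sum sum0 sum_fin) (Zlim_fin s) aeY => x sx Zx Yx.
pose v n : R := ((fine (Zlim s x) - fine (Yr n s x)) ^+ 2)%R.
have vE n : sqdist (Zlim s) (Yr n s) x = (v n)%:E.
  rewrite /sqdist -(fineK Zx) -(fineK (Yx n)) -EFinB abse_EFin -EFin_expe.
  by rewrite real_normK ?num_real.
have v_cvg : v @ \oo --> (0 : R)%R.
  apply: cvg_series_cvg_0; apply: nnseries_is_cvg => [n|]; first exact: sqr_ge0.
  move: sx; under eq_eseriesr do rewrite vE.
  by move=> sx; rewrite ltey_eq sx.
rewrite -(fineK Zx) -(funext (fun n => fineK (Yx n))).
apply: cvg_EFin; first exact: nearW.
apply/cvgrPdist_lt => e e0; have e20 : (0 < e ^+ 2)%R by rewrite exprn_gt0.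
move/cvgrPdist_lt : v_cvg => /(_ _ e20); apply: filterS => n.
rewrite sub0r normrN ger0_norm ?sqr_ge0// /v -real_normK ?num_real//.
by rewrite ltr_pXn2r// nnegrE// ltW.
Qed.

End cascade_limit.

(** * Summation over words *)

Section complex_convergence.
Context (R : realType).
Local Open Scope complex_scope.

Lemma cvg_real_complex (T : Type) (F : set_system T) (FF : Filter F)
    (f : T -> R) (l : R) :
  f @ F --> l -> (fun t => (f t)%:C : R[i]) @ F --> (l%:C : R[i]).
Proof.
move=> fl; apply/(@cvgrPdist_lt _ (R[i])^o) => e e0.
have [r r0 ->] : exists2 r : R, 0 < r & e = r%:C.
  move: e0; case: e => a b; rewrite ltcE /= => /andP[/eqP b0 a0].
  by exists a; rewrite // b0.
move/cvgrPdist_lt : fl => /(_ _ r0).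
apply: filterS => t.
rewrite -rmorphB normc_def /= expr0n /= addr0 sqrtr_sqr.
by rewrite ltcR.
Qed.

(** For non-negative terms the net of finite partial sums is monotone, and its
    supremum is the sum. *)
Lemma sums_to_nonneg (I : choiceType) (D : set I) (f : I -> R) (l : R) :
  (forall i, D i -> 0 <= f i) -> (\esum_(i in D) (f i)%:E = l%:E)%E ->
  sums_to D (fun i => (f i)%:C) l%:C.
Proof.
move=> f0 fl; rewrite /sums_to.
rewrite (_ : (fun J => _) = fun J : {fset I} => (\sum_(i <- J | `[< D i >]) f i)%:C);
  last by apply/funext => J; rewrite rmorph_sum.
have FF : Filter (filter_from setT (fun A : {fset I} => [set B | (A `<=` B)%fset])).
  apply: filter_from_filter; first by exists fset0.
  move=> A B _ _; exists (A `|` B)%fset => // C /= /fsubUsetP[]; split => //.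
apply: cvg_real_complex.
have partial_le (B : {fset I}) : \sum_(i <- B | `[< D i >]) f i <= l.
  rewrite -lee_fin -fl -sumEFin; apply: ereal_sup_ubound.
  exists [set` [fset i in B | `[< D i >]]%fset].
    by split=> // i; rewrite /= !inE => /andP[_ /asboolP].
  by rewrite fsbig_finite//= set_fsetK [RHS]big_fset_condE.
apply/cvgrPdist_lt => e e0.
have [_ [A [fA AD] <-]] : exists2 y, [set \sum_(x \in A) (f x)%:E | A in fsets D] y &
    (l%:E - e%:E < y)%E.
  have := @ub_ereal_sup_adherent R [set \sum_(x \in A) (f x)%:E | A in fsets D] e e0.
  by rewrite -/(esum _ _) fl => /(_ isT).
rewrite fsbig_finite// sumEFin -EFinB lte_fin => Al.
exists (fset_set A) => // B /= AB.
rewrite ger0_norm ?subr_ge0// ltrBlDr -ltrBlDl (lt_le_trans Al)//.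
pose g i := if `[< D i >] then f i else 0.
have g0 i : 0 <= g i by rewrite /g; case: asboolP => // /f0.
have -> : \sum_(i <- fset_set A) f i = \sum_(i <- fset_set A) g i.
  rewrite big_seq [RHS]big_seq; apply: eq_bigr => i.
  by rewrite in_fset_set// inE /g => /AD Di; rewrite asboolT.
rewrite [leRHS]big_mkcond -[leRHS]/(\sum_(i <- B) g i) [leRHS](big_fsetID _ (mem (fset_set A)))/=.
rewrite (_ : [fset x in B | x \in fset_set A]%fset = fset_set A).
  by rewrite lerDl sumr_ge0.
apply/fsetP => i; rewrite !inE andbC; case: (boolP (i \in fset_set A)) => //= iA.
exact: (fsubsetP AB).
Qed.

End complex_convergence.

Section tree_sums.
Local Open Scope ereal_scope.
Context (R : realType).

Lemma esumZ_le (I : choiceType) (D : set I) (f : I -> \bar R) (c : R) :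
  (0 <= c)%R -> (forall i, 0 <= f i) ->
  \esum_(i in D) (c%:E * f i) <= c%:E * \esum_(i in D) f i.
Proof.
move=> c0 f0; apply: ge_ereal_sup => _ [A [fA AD] <-].
rewrite -ge0_mule_fsumr//.
apply: lee_wpmul2l => //; apply: ereal_sup_ubound; by exists A.
Qed.

Lemma ge0_esumZl (I : choiceType) (D : set I) (f : I -> \bar R) (c : R) :
  (0 <= c)%R -> (forall i, 0 <= f i) ->
  \esum_(i in D) (c%:E * f i) = c%:E * \esum_(i in D) f i.
Proof.
rewrite le_eqVlt => /predU1P[<- f0|c0 f0].
  by rewrite mul0e esum1// => i _; rewrite mul0e.
apply/eqP; rewrite eq_le (esumZ_le D (ltW c0) f0)/=.
rewrite muleC -lee_pdivlMr// muleC.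
have := @esumZ_le I D (fun i => c%:E * f i) c^-1.
rewrite invr_ge0 (ltW c0) => /(_ isT) H.
rewrite -[X in X <= _](_ : \esum_(i in D) (c^-1%:E * (c%:E * f i)) = _).
  by apply: H => i; rewrite mule_ge0// lee_fin ltW.
by apply: eq_esum => i _; rewrite muleA -EFinM mulVf ?gt_eqF// mul1e.
Qed.

Definition paths := (pathspace (seq nat) R[i] * pathspace (seq nat) (Rseq R))%type.

(** Only the real part matters, since the law of interest sits on the non-negative
    reals; the absolute value plays the same role as in [weight]. *)
Definition modulus (z : R[i]) : \bar R := (`|complex.Re z|)%:E.

Fixpoint tree_sum n (u : seq nat) (p : paths) : \bar R :=
  if n is k.+1 then
    \sum_(0 <= j <oo) (weight (p.2 u) j * (tree_sum k (rcons u j) p * modulus (p.1 (rcons u j))))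
  else 1.

Definition tree_term n (u w : seq nat) (p : paths) : R :=
  \prod_(k < n) (`|p.2 (u ++ take k w) (nth 0%N w k)| *
                 `|complex.Re (p.1 (u ++ take k.+1 w))|)%R.

Lemma tree_term_ge0 n u w p : (0 <= tree_term n u w p)%R.
Proof. by apply: prodr_ge0 => k _; rewrite mulr_ge0. Qed.

Lemma tree_sum_ge0 n u p : 0 <= tree_sum n u p.
Proof.
elim: n u => [|n IH] u /=; first exact: lee01.
by apply: nneseries_ge0 => j _ _; rewrite !mule_ge0// lee_fin.
Qed.

Lemma tree_termS n u j w p : tree_term n.+1 u (j :: w) p =
  (`|p.2 u j| * `|complex.Re (p.1 (rcons u j))| * tree_term n (rcons u j) w p)%R.
Proof.
rewrite /tree_term big_ord_recl /= cats0 take0 cats1; congr (_ * _)%R.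
by apply: eq_bigr => k _; rewrite /= !cat_rcons.
Qed.

(** A non-empty word is a first letter and a word; sums over words are grouped by
    the first letter. *)
Lemma tree_sum_esum n u p :
  tree_sum n u p = \esum_(w in [set w : seq nat | size w = n]) (tree_term n u w p)%:E.
Proof.
elim: n u => [|n IH] u.
  rewrite (_ : [set w : seq nat | size w = 0%N] = [set [::]]).
    by rewrite esum_set1 /tree_term ?big_ord0.
  by apply/seteqP; split => [w /size0nil ->|w ->].
have bij : set_bij ([set: nat] `*`` (fun=> [set w : seq nat | size w = n]))
    [set w : seq nat | size w = n.+1] (fun jw => jw.1 :: jw.2).
  split.
  - by move=> [j w] /= [_ ->].
  - by move=> [j w] [j' w'] _ _ /= [-> ->].
  - by move=> [|j w]//= [sw]; exists (j, w).
rewrite (@reindex_esum _ _ _ _ _ _ _ bij) -(esum_esum (a := fun j w => (tree_term n.+1 u (j :: w) p)%:E));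
  last by move=> *; rewrite lee_fin tree_term_ge0.
rewrite -nneseries_esumT; last first.
  by move=> j; apply: esum_ge0 => w _; rewrite lee_fin tree_term_ge0.
apply: eq_eseriesr => j _.
under eq_esum do rewrite tree_termS EFinM.
rewrite ge0_esumZl ?mulr_ge0//; last by move=> w; rewrite lee_fin tree_term_ge0.
by rewrite -IH EFinM -muleA; congr (_ * _); rewrite muleC.
Qed.

Lemma measurable_modulus : measurable_fun setT modulus.
Proof.
apply/measurable_EFinP; apply: measurableT_comp => //.
move=> _ A mA; apply: sub_sigma_algebra; left; exists A => //.
Qed.

Lemma measurable_tree_sum n u : measurable_fun setT (tree_sum n u).
Proof.
elim: n u => [|n IH] u; first exact: measurable_cst.
apply: ge0_emeasurable_sum => [j p _ _|j _].
  by rewrite !mule_ge0// ?tree_sum_ge0// lee_fin.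
apply: emeasurable_funM.
  apply: measurableT_comp (measurable_weight j) _.
  apply: measurableT_comp (@measurable_coordinate _ _ (Rseq R) u) _.
  exact: measurable_snd.
apply: emeasurable_funM => //.
apply: measurableT_comp measurable_modulus _.
apply: measurableT_comp (@measurable_coordinate _ _ R[i] (rcons u j)) _.
exact: measurable_fst.
Qed.

End tree_sums.

(** * Copies of the limit along a spine *)

Section iid_tools.
Context (R : realType) d (Om : measurableType d) (P : probability Om R).

Lemma iid_reindex (I K : choiceType) d' (E : measurableType d')
    (X : I -> {RV P >-> E}) (L : set E -> \bar R) (g : K -> I) :
  injective g -> iid_family setT X L -> iid_family setT (fun k => X (g k)) L.
Proof.
move=> gI [iX lX]; split; last by move=> k _; exact: lX.
apply: (independent_groups (D := fun k => [set g k]) iX).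
  by move=> k; exact: depends_on_coordinate.
move=> k l kl; apply/disj_setPS => i [/= ->] /gI kl'.
by rewrite kl' eqxx in kl.
Qed.

Lemma ae_forall_count (I : countType) (Q : I -> Om -> Prop) :
  (forall i, {ae P, forall x, Q i x}) -> {ae P, forall x, forall i, Q i x}.
Proof.
move=> H; have := @ae_foralln _ _ _ P (fun n x => forall i, choice.unpickle n = Some i -> Q i x).
have HQ n : {ae P, forall x, forall i, choice.unpickle n = Some i -> Q i x}.
  case e : (choice.unpickle n) => [i|]; last by apply: nearW.
  by apply: filterS (H i) => x Qx j [<-].
move=> /(_ HQ); apply: filterS => x Hx i.
by apply: (Hx (choice.pickle i)); exact: choice.pickleK.
Qed.

Lemma ae_of_probability1 (A : set Om) : measurable A -> P A = 1%E ->
  {ae P, forall x, A x}.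
Proof.
move=> mA PA; exists (~` A); split => //; first exact: measurableC.
by rewrite probability_setC// PA subee.
Qed.

Lemma probability1_of_ae (A : set Om) : measurable A -> {ae P, forall x, A x} ->
  P A = 1%E.
Proof.
move=> mA [N [mN PN AN]].
have PC0 : P (~` A) = 0%E.
  apply/eqP; rewrite eq_le measure_ge0 andbT -PN.
  by apply: le_measure; rewrite ?inE//; exact: measurableC.
by rewrite -(setCK A) probability_setC ?PC0 ?sube0//; exact: measurableC.
Qed.

End iid_tools.

Section spine.
Implicit Types (u w : seq nat) (s t : word).

(** All letters of a spine carry the mark [false].  The leading letter leaves room
    for the copy of the limit attached to the empty word, see [offspine]. *)
Definition spine u : word := (0%N, false) :: [seq (j, false) | j <- u].

(** The spine of [w] with the mark of its last letter changed to [true]; for the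
    empty word this is the sibling of the root of the spine. *)
Definition offspine w : word :=
  rcons [seq (j, false) | j <- belast 0%N w] (last 0%N w, true).

Lemma spine_rcons u j : spine (rcons u j) = rcons (spine u) (j, false).
Proof. by rewrite /spine map_rcons. Qed.

Lemma offspine_rcons u j : offspine (rcons u j) = rcons (spine u) (j, true).
Proof. by rewrite /offspine belast_rcons last_rcons. Qed.

Lemma spine_inj : injective spine.
Proof. by move=> u v [] /inj_map; apply => i j []. Qed.

Lemma size_offspine w : size (offspine w) = (size w).+1.
Proof. by rewrite size_rcons size_map size_belast. Qed.

(** The length of [w] can be read off any descendant of [offspine w] as the position
    of the first mark [true]; this separates the subtrees hanging off the spine. *)
Lemma offspine_find w t : subtree (offspine w) t ->
  find id (map snd t) = size w.
Proof.
move=> /prefixP[v ->]; rewrite map_cat find_cat map_rcons -cats1 has_cat /= orbT.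
rewrite find_cat /= -map_comp addn0 size_map size_belast.
suff -> : has id (map (snd \o (fun j : nat => (j, false))) (belast 0%N w)) = false by [].
by apply/hasPn => b /mapP[j _ ->].
Qed.

Lemma offspine_inj : injective offspine.
Proof.
move=> w w' /(congr1 (map fst)); rewrite !map_rcons -!map_comp !map_id -!lastI.
by case.
Qed.

Lemma offspine_disj w w' : w != w' ->
  [disjoint subtree (offspine w) & subtree (offspine w')].
Proof.
move=> ww'; apply/disj_setPS => t [tw tw'].
have sww' : size w = size w' by rewrite -(offspine_find tw) (offspine_find tw').
move/negP: ww'; apply; apply/eqP/offspine_inj.
move: tw tw' => /prefixP[v ->] /prefixP[v'] /(congr1 (take (size w).+1)).
by rewrite {2}sww' !take_cat !size_offspine sww' !ltnn subnn !take0 !cats0.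
Qed.

Lemma spine_not_off u w : ~ subtree (offspine w) (spine u).
Proof.
move=> uw; have := offspine_find uw.
have hF : has id (map snd (spine u)) = false.
  by apply/hasPn => b /mapP[[j c]] /predU1P[[_ ->] ->//|/mapP[k _ [_ ->]] ->].
have := subtree_size uw; rewrite size_offspine => lt e.
by move: hF; rewrite has_find e size_map lt.
Qed.

End spine.

Lemma limn_einf_esup_cvg (R : realType) (v : nat -> \bar R) :
  limn_einf v = limn_esup v -> v @ \oo --> limn_esup v.
Proof.
move=> e; apply: (@squeeze_cvge _ _ _ _ (einfs v) _ (esups v)).
- apply: nearW => n; apply/andP; split.
    by apply: ereal_inf_lbound; exists n => /=.
  by apply: ereal_sup_ubound; exists n => /=.
- by rewrite -e limn_einf_lim; exact: is_cvg_einfs.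
- by rewrite limn_esup_lim; exact: is_cvg_esups.
Qed.

Lemma ae_eq_preimage (R : realType) d (Om : measurableType d)
    (P : probability Om R) d' (T : measurableType d') (f g : Om -> T) (B : set T) :
  measurable_fun setT f -> measurable_fun setT g -> measurable B ->
  {ae P, forall x, f x = g x} -> P (f @^-1` B) = P (g @^-1` B).
Proof.
move=> mf mg mB fg.
have mfB : measurable (f @^-1` B) by rewrite -[X in measurable X]setTI; exact: mf.
have mgB : measurable (g @^-1` B) by rewrite -[X in measurable X]setTI; exact: mg.
rewrite -(setIT (f @^-1` B)) -(setIT (g @^-1` B)) -!integral_indic//.
apply: ge0_ae_eq_integral => //.
- by apply/measurable_EFinP; exact: measurable_indic.
- by apply/measurable_EFinP; exact: measurable_indic.
- apply: filterS fg => x e _; rewrite !indicE.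
  by rewrite (_ : (x \in f @^-1` B) = (x \in g @^-1` B))//; apply/idP/idP; rewrite !inE /= e.
Qed.

Section limit_law.
Context (R : realType).
Context d0 (Om0 : measurableType d0) (P0 : probability Om0 R).
Variable a0 : {RV P0 >-> Rseq R}.
Context d (Om : measurableType d) (P : probability Om R).
Variable X : word -> {RV P >-> Rseq R}.
Hypothesis X_iid : iid_family setT X (distribution P0 a0).

Local Open Scope complex_scope.

Lemma Zreal_measurable s : measurable_fun setT (fun x => fine (Zlim X s x)).
Proof. by apply: measurableT_comp (Zlim_measurable X s). Qed.

Definition Zreal s : {RV P >-> R} := mfun_Sub (mem_set (Zreal_measurable s)).

Definition Zcomplex s : {RV P >-> R[i]} := real_complex R \o Zreal s.

Definition Zlaw : probability R[i] R := distribution P (Zcomplex [::]).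

Lemma Zlim_shift s x :
  Zlim X s x = cascade_limit [::] (random_path (fun u => X (s ++ u)) x).
Proof. by rewrite /Zlim -[in LHS](cats0 s) cascade_limit_shift. Qed.

Lemma cat_inj s : injective (cat s : word -> word).
Proof. by move=> u v /eqP; rewrite eqseq_cat// => /andP[_ /eqP]. Qed.

(** The limit at [s] is the functional of the root evaluated at the shifted family,
    which has the same law as the family itself. *)
Lemma Zlim_law s B : measurable B ->
  P (Zlim X s @^-1` B) = P (Zlim X [::] @^-1` B).
Proof.
move=> mB; rewrite (_ : Zlim X s @^-1` B =
    random_path (fun u => X (s ++ u)) @^-1` (cascade_limit [::] @^-1` B)); last first.
  by apply/seteqP; split => x; rewrite /= Zlim_shift.
apply: (random_path_law (iid_reindex (@cat_inj s) X_iid) X_iid).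
by rewrite -[X in measurable X]setTI; exact: measurable_cascade_limit.
Qed.

Let measurable_fine_complex B : measurable B ->
  measurable (@fine R @^-1` (real_complex R @^-1` B)).
Proof.
move=> mB; rewrite -[X in measurable X]setTI; apply: fine_measurable => //.
by rewrite -[X in measurable X]setTI; exact: measurable_real_complex.
Qed.

Lemma Zcomplex_law s : has_law (Zcomplex s) Zlaw.
Proof. by move=> B mB; exact: (Zlim_law s (measurable_fine_complex mB)). Qed.

Lemma Zcomplex_depends s : depends_on X (subtree s) (Zcomplex s).
Proof.
move=> _ B mB; rewrite setTI.
have := @Zlim_depends _ _ _ _ X s measurableT _ (measurable_fine_complex mB).
by rewrite setTI.
Qed.

(** The weights are read on the spine and the copies of the limit in the pairwise
    disjoint subtrees that hang off it. *)
Lemma T_family_canonical :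
  T_family a0 Zlaw (fun u => X (spine u)) (fun w => Zcomplex (offspine w)).
Proof.
have DW w : depends_on X (subtree (offspine w)) (Zcomplex (offspine w)).
  exact: Zcomplex_depends.
split.
- split; last by move=> w _; exact: Zcomplex_law.
  exact: (independent_groups X_iid.1 DW offspine_disj).
- exact: (iid_reindex spine_inj X_iid).
- move=> A B /(family_depends_sub DW) sA sB.
  have DX u : depends_on X [set spine u] (X (spine u)) by exact: depends_on_coordinate.
  move: sB => /(family_depends_sub DX) sB.
  apply: (independent_disjoint X_iid.1 _ sA sB).
  by apply/disj_setPS => t [[w _ wt] [u _ /= tu]]; apply: (@spine_not_off u w); rewrite -tu.
Qed.

Lemma S2_family_canonical :
  S2_family a0 Zlaw (X [::]) (fun jb => Zcomplex [:: jb]).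
Proof.
have DW (jb : nat * bool) : depends_on X (subtree [:: jb]) (Zcomplex [:: jb]).
  exact: Zcomplex_depends.
split.
- split; last by move=> w _; exact: Zcomplex_law.
  apply: (independent_groups X_iid.1 DW) => jb jb'.
  exact: (@subtree_rcons_disj [::]).
- exact: X_iid.2.
- move=> A B /(family_depends_sub DW) sA sB.
  have sB' := depends_on_preimage (depends_on_coordinate (X := X) (erefl : [set [::]] [::])) sB.
  apply: (independent_disjoint X_iid.1 _ sA sB').
  by apply/disj_setPS => t [[jb _ tjb] /= te]; move: tjb; rewrite te => /subtree_size.
Qed.

End limit_law.

(** * Transfer to arbitrary probability spaces *)

Section transfer.
Context (R : realType).
Context d0 (Om0 : measurableType d0) (P0 : probability Om0 R).
Variable a0 : {RV P0 >-> Rseq R}.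
Context d (Om : measurableType d) (P : probability Om R).
Variable X : word -> {RV P >-> Rseq R}.
Hypothesis X_iid : iid_family setT X (distribution P0 a0).
Hypothesis a0_ge0 : forall y j, 0 <= a0 y j.
Hypothesis a0_mean : (\int[P0]_y total (a0 y))%E = 1%E.
Variables s2 o2 alpha : R.
Hypotheses (s2E : diag_moment a0 = s2%:E) (o2E : offdiag_moment a0 = o2%:E).
Hypotheses (s2_ge0 : 0 <= s2) (alpha_ge1 : 1 <= alpha).
Hypothesis alpha_fix : s2 * alpha ^+ 2 + o2 = alpha.
Hypothesis alpha_small : 2 * s2 * alpha <= 1.

Local Open Scope complex_scope.

Let Z_fin s := Zlim_fin X_iid a0_mean s2E o2E s2_ge0 alpha_ge1 alpha_fix alpha_small s.
Let Z_fix s :=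
  Zlim_fixed_point X_iid a0_mean s2E o2E s2_ge0 alpha_ge1 alpha_fix alpha_small s.
Let Y_fin n s :=
  Yr_fin X_iid a0_mean s2E o2E s2_ge0 alpha_ge1 alpha_fix alpha_small n s.
Let Y_cvg s := Yr_cvg X_iid a0_mean s2E o2E s2_ge0 alpha_ge1 alpha_fix alpha_small s.

Definition nonneg_weights : set (Rseq R) := [set r | forall j, 0 <= r j].
Definition nonneg_reals : set R[i] := [set z | complex.Im z = 0 /\ 0 <= complex.Re z].

Lemma measurable_nonneg_weights : measurable nonneg_weights.
Proof.
rewrite (_ : nonneg_weights = \bigcap_j ((fun r : Rseq R => r j) @^-1` `[0, +oo[)).
  apply: bigcapT_measurable => j; rewrite -[X in measurable X]setTI.
  exact: measurable_Rseq.
apply/seteqP; split => r H j => [_|]; first by rewrite /= in_itv /= andbT.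
by have := H j Logic.I; rewrite /= in_itv /= andbT.
Qed.

Lemma measurable_nonneg_reals : measurable nonneg_reals.
Proof.
rewrite (_ : nonneg_reals =
  @complex.Im R @^-1` [set 0] `&` @complex.Re R @^-1` `[0, +oo[); last first.
  by apply/seteqP; split => z /=; rewrite in_itv /= andbT.
apply: measurableI; apply: sub_sigma_algebra.
  by right; exists [set 0] => //; rewrite setTI.
by left; exists `[0, +oo[%classic => //; rewrite setTI.
Qed.

Lemma nonneg_weights_ae d' (Om' : measurableType d') (P' : probability Om' R)
    (a : {RV P' >-> Rseq R}) : has_law a (distribution P0 a0) ->
  {ae P', forall x, forall j, 0 <= a x j}.
Proof.
move=> la; apply: (@ae_of_probability1 _ _ _ P' (a @^-1` nonneg_weights)).
  by rewrite -[X in measurable X]setTI; apply: measurable_funPT => //;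
    exact: measurable_nonneg_weights.
apply: (etrans (la _ measurable_nonneg_weights)).
rewrite -[LHS]/(P0 (a0 @^-1` nonneg_weights)).
by rewrite (_ : _ @^-1` _ = setT) ?probability_setT// -subTset => x _ j; exact: a0_ge0.
Qed.

Lemma Zlaw_nonneg_reals : Zlaw X nonneg_reals = 1%E.
Proof.
rewrite -[LHS]/(P (Zcomplex X [::] @^-1` nonneg_reals)).
rewrite (_ : _ @^-1` _ = setT) ?probability_setT// -subTset => x _ /=.
by split => //=; apply: fine_ge0; exact: Zlim_ge0.
Qed.

Lemma nonneg_reals_ae d' (Om' : measurableType d') (P' : probability Om' R)
    (W : {RV P' >-> R[i]}) : has_law W (Zlaw X) ->
  {ae P', forall x, nonneg_reals (W x)}.
Proof.
move=> lW; apply: (@ae_of_probability1 _ _ _ P' (W @^-1` nonneg_reals)).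
  by rewrite -[X in measurable X]setTI; apply: measurable_funPT => //;
    exact: measurable_nonneg_reals.
exact: (etrans (lW _ measurable_nonneg_reals) Zlaw_nonneg_reals).
Qed.

Lemma nonneg_reals_modulus z : nonneg_reals z -> z = `|complex.Re z|%:C.
Proof. by case: z => x y /= [/= -> x0]; rewrite ger0_norm. Qed.

Lemma modulus_Zcomplex s x : Zlim X s x \is a fin_num ->
  modulus (Zcomplex X s x) = Zlim X s x.
Proof.
by move=> Zx; rewrite /modulus /= ger0_norm ?fineK//; apply: fine_ge0; exact: Zlim_ge0.
Qed.

Let X_spine (u : seq nat) := X (spine u).
Let Z_off (w : seq nat) := Zcomplex X (offspine w).

Definition sample d' (Om' : measurableType d') (P' : probability Om' R)
    (a : seq nat -> {RV P' >-> Rseq R}) (W : seq nat -> {RV P' >-> R[i]}) (x : Om') :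
  paths R := (random_path W x, random_path a x).

Lemma sample_measurable d' (Om' : measurableType d') (P' : probability Om' R)
    (a : seq nat -> {RV P' >-> Rseq R}) (W : seq nat -> {RV P' >-> R[i]}) :
  measurable_fun setT (sample a W).
Proof. by apply: measurable_fun_pair; exact: random_path_measurable. Qed.

Lemma tree_sum_spine x : (forall s, Zlim X s x \is a fin_num) ->
  forall n u, tree_sum n u (sample X_spine Z_off x) = Yr X n (spine u) x.
Proof.
move=> Zx; elim => [//|n IH] u /=; apply: eq_eseriesr => j _.
rewrite IH spine_rcons; congr (_ * (_ * _))%E.
by rewrite /random_path /Z_off offspine_rcons modulus_Zcomplex.
Qed.

Definition tree_limit (p : paths R) : \bar R := limn_esup (fun n => tree_sum n [::] p).

Lemma measurable_tree_limit : measurable_fun setT tree_limit.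
Proof. by apply: measurable_fun_limn_esup => n; exact: measurable_tree_sum. Qed.

(** Convergence is expressed through upper and lower limits to make the event
    visibly measurable. *)
Definition convergent_trees : set (paths R) :=
  (\bigcap_n [set p | tree_sum n [::] p \is a fin_num]) `&`
  [set p | tree_limit p \is a fin_num] `&`
  [set p | limn_einf (fun n => tree_sum n [::] p) = tree_limit p].

Lemma measurable_convergent_trees : measurable convergent_trees.
Proof.
apply: measurableI; first apply: measurableI.
- apply: bigcapT_measurable => n; rewrite -[X in measurable X]setTI.
  by apply: emeasurable_fin_num => //; exact: measurable_tree_sum.
- rewrite -[X in measurable X]setTI.
  by apply: emeasurable_fin_num => //; exact: measurable_tree_limit.
- rewrite -[X in measurable X]setTI; apply: measurable_eqe => //.
    by apply: measurable_fun_limn_einf => n; exact: measurable_tree_sum.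
  exact: measurable_tree_limit.
Qed.

Lemma canonical_convergent : {ae P, forall x,
  convergent_trees (sample X_spine Z_off x) /\
  tree_limit (sample X_spine Z_off x) = Zlim X (spine [::]) x}.
Proof.
have aeZ := ae_forall_count Z_fin.
have aeY := ae_foralln (fun n => Y_fin n (spine [::])).
apply: filterS3 aeZ aeY (Y_cvg (spine [::])) => x Zx Yx Yc.
have tE n := tree_sum_spine Zx n [::].
have [ei es] := cvg_limn_einf_sup Yc.
have lE : tree_limit (sample X_spine Z_off x) = Zlim X (spine [::]) x.
  by rewrite /tree_limit (funext tE).
split=> //; split; first split.
- by move=> n _ /=; rewrite tE.
- by rewrite /= lE.
- by rewrite /= lE (funext tE).
Qed.

(** The event of convergence and the law of the limit depend on the joint law of
    the families only, so they are those of the canonical family. *)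
Lemma T_limit_Zlaw d' (Om' : measurableType d') (P' : probability Om' R)
    (a : seq nat -> {RV P' >-> Rseq R}) (W : seq nat -> {RV P' >-> R[i]}) :
  T_family a0 (Zlaw X) a W -> T_limit_law a W (Zlaw X).
Proof.
move=> [W_iid a_iid Wa].
have [W_iid1 a_iid1 Wa1] := T_family_canonical X_iid.
have law C : measurable C ->
    P' (sample a W @^-1` C) = P (sample X_spine Z_off @^-1` C).
  exact: (random_paths_joint_law W_iid W_iid1 a_iid a_iid1).
have mY : measurable_fun setT (fun x => fine (tree_limit (sample a W x))).
  apply: measurableT_comp => //.
  by apply: measurableT_comp measurable_tree_limit _; exact: sample_measurable.
pose Yrv : {RV P' >-> R} := mfun_Sub (mem_set mY).
pose Y : {RV P' >-> R[i]} := real_complex R \o Yrv.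
exists (fun n x => (fine (tree_sum n [::] (sample a W x)))%:C), Y.
have good : {ae P', forall x, convergent_trees (sample a W x)}.
  apply: (@ae_of_probability1 _ _ _ P' (sample a W @^-1` convergent_trees)).
    by rewrite -[X in measurable X]setTI; apply: sample_measurable => //;
      exact: measurable_convergent_trees.
  rewrite (law _ measurable_convergent_trees); apply: probability1_of_ae.
    by rewrite -[X in measurable X]setTI; apply: sample_measurable => //;
      exact: measurable_convergent_trees.
  by apply: filterS canonical_convergent => x [].
have a_nonneg : {ae P', forall x, forall u j, 0 <= a u x j}.
  by apply: ae_forall_count => u; apply: nonneg_weights_ae; exact: a_iid.2.
have W_nonneg : {ae P', forall x, forall w, nonneg_reals (W w x)}.
  by apply: ae_forall_count => w; apply: nonneg_reals_ae; exact: W_iid.2.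
split.
- apply: filterS3 good a_nonneg W_nonneg => x [[fx _] _] ax Wx n.
  have -> : T_term a W n x = fun w => (tree_term n [::] w (sample a W x))%:C.
    apply/funext => w; rewrite /T_term /tree_term rmorph_prod.
    apply: eq_bigr => k _; rewrite rmorphM /= /random_path.
    by rewrite (ger0_norm (ax _ _)) -(nonneg_reals_modulus (Wx _)).
  apply: sums_to_nonneg => [w _|]; first exact: tree_term_ge0.
  by rewrite -tree_sum_esum fineK//; exact: fx.
- apply: filterS good => x [[_ tx] /limn_einf_esup_cvg tc].
  by apply: cvg_real_complex; apply: fine_cvg; rewrite fineK.
- move=> B mB.
  have mC : measurable ((fun p => (fine (tree_limit p))%:C : R[i]) @^-1` B).
    rewrite -[X in measurable X]setTI.
    have : measurable_fun setT (real_complex R \o (@fine R \o tree_limit)).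
      apply: measurableT_comp; first exact: measurable_real_complex.
      by apply: measurableT_comp => //; exact: measurable_tree_limit.
    exact.
  transitivity (P (sample X_spine Z_off @^-1`
      ((fun p => (fine (tree_limit p))%:C : R[i]) @^-1` B))); first exact: law.
  rewrite -(Zcomplex_law X_iid (spine [::]) mB).
  apply: (@ae_eq_preimage _ _ _ P _ _
    (fun x => (fine (tree_limit (sample X_spine Z_off x)))%:C) (Zcomplex X (spine [::]))) => //.
  + apply: measurableT_comp; first exact: measurable_real_complex.
    apply: measurableT_comp => //.
    by apply: measurableT_comp measurable_tree_limit _; exact: sample_measurable.
  + by apply: filterS canonical_convergent => x [_ ->].
Qed.

Definition pair_sum (p : pathspace (nat * bool)%type R[i] * Rseq R) : \bar R :=
  (\sum_(0 <= j <oo)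
    (weight p.2 j * (modulus (p.1 (j, false)) * modulus (p.1 (j, true)))))%E.

Lemma measurable_pair_sum : measurable_fun setT pair_sum.
Proof.
apply: ge0_emeasurable_sum => [j p _ _|j _]; first by rewrite !mule_ge0// lee_fin.
apply: emeasurable_funM.
  by apply: measurableT_comp (measurable_weight j) _; exact: measurable_snd.
apply: emeasurable_funM.
  apply: measurableT_comp (@measurable_modulus R) _.
  apply: measurableT_comp (@measurable_coordinate _ _ R[i] (j, false)) _.
  exact: measurable_fst.
apply: measurableT_comp (@measurable_modulus R) _.
apply: measurableT_comp (@measurable_coordinate _ _ R[i] (j, true)) _.
exact: measurable_fst.
Qed.

Let Z_child (jb : nat * bool) := Zcomplex X [:: jb].

Definition pair_sample d' (Om' : measurableType d') (P' : probability Om' R)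
    (a : {RV P' >-> Rseq R}) (W : (nat * bool)%type -> {RV P' >-> R[i]}) (x : Om') :
    pathspace (nat * bool)%type R[i] * Rseq R :=
  (random_path W x, a x).

Lemma pair_sample_measurable d' (Om' : measurableType d') (P' : probability Om' R)
    (a : {RV P' >-> Rseq R}) (W : (nat * bool)%type -> {RV P' >-> R[i]}) :
  measurable_fun setT (pair_sample a W).
Proof.
by apply: measurable_fun_pair; [exact: random_path_measurable|exact: measurable_funPT].
Qed.

Lemma canonical_pair_sum : {ae P, forall x,
  pair_sum (pair_sample (X [::]) Z_child x) = Zlim X [::] x /\
  Zlim X [::] x \is a fin_num}.
Proof.
have aeZ := ae_forall_count Z_fin.
apply: filterS2 aeZ (Z_fix [::]) => x Zx Zf; split => //.
rewrite Zf; apply: eq_eseriesr => j _; congr (_ * _)%E.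
by rewrite /random_path /Z_child !modulus_Zcomplex.
Qed.

Lemma pair_sample_law d' (Om' : measurableType d') (P' : probability Om' R)
    (a : {RV P' >-> Rseq R}) (W : (nat * bool)%type -> {RV P' >-> R[i]}) :
  S2_family a0 (Zlaw X) a W -> forall C, measurable C ->
  P' (pair_sample a W @^-1` C) = P (pair_sample (X [::]) Z_child @^-1` C).
Proof.
move=> [W_iid la Wa] C mC.
have [W_iid1 la1 Wa1] := S2_family_canonical X_iid.
pose H d2 (Om2 : measurableType d2) (P2 : probability Om2 R)
    (V : (nat * bool)%type -> {RV P2 >-> R[i]}) :
    {RV P2 >-> pathspace (nat * bool)%type R[i]} :=
  mfun_Sub (mem_set (random_path_measurable V)).
pose m1 : probability (pathspace (nat * bool)%type R[i]) R :=
  distribution P (H _ _ P Z_child).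
pose m2 : probability (Rseq R) R := distribution P0 a0.
transitivity ((m1 \x m2)%E C).
  apply: (@joint_law _ _ _ _ R _ Om' P' m1 m2 (H _ _ P' W) a) => //.
    by move=> B mB; exact: (random_path_law W_iid W_iid1).
  move=> A B HA aB; apply: Wa => //.
  exact: (depends_on_preimage (@random_path_depends _ _ _ _ _ _ _ W)).
apply/esym/(@joint_law _ _ _ _ R _ Om P m1 m2 (H _ _ P Z_child) (X [::])) => //.
move=> A B HA aB; apply: Wa1 => //.
exact: (depends_on_preimage (@random_path_depends _ _ _ _ _ _ _ Z_child)).
Qed.

(** As for [T], the sum is a measurable functional of the sample and is finite and
    equal to the limit of the cascade on the canonical family. *)
Lemma S2_sum_Zlaw d' (Om' : measurableType d') (P' : probability Om' R)
    (a : {RV P' >-> Rseq R}) (W : (nat * bool)%type -> {RV P' >-> R[i]}) :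
  S2_family a0 (Zlaw X) a W -> S2_sum_law a W (Zlaw X).
Proof.
move=> fam; have law := pair_sample_law fam; case: fam => W_iid la _.
have m_fin : measurable [set p | pair_sum p \is a fin_num].
  rewrite -[X in measurable X]setTI; apply: emeasurable_fin_num => //.
  exact: measurable_pair_sum.
have mY : measurable_fun setT (fun x => fine (pair_sum (pair_sample a W x))).
  apply: measurableT_comp => //.
  by apply: measurableT_comp measurable_pair_sum _; exact: pair_sample_measurable.
pose Yrv : {RV P' >-> R} := mfun_Sub (mem_set mY).
pose Y : {RV P' >-> R[i]} := real_complex R \o Yrv.
exists Y.
- have good : {ae P', forall x, pair_sum (pair_sample a W x) \is a fin_num}.
    apply: (@ae_of_probability1 _ _ _ P'
      (pair_sample a W @^-1` [set p | pair_sum p \is a fin_num])).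
      by rewrite -[X in measurable X]setTI; exact: pair_sample_measurable.
    rewrite (law _ m_fin); apply: probability1_of_ae.
      by rewrite -[X in measurable X]setTI; exact: pair_sample_measurable.
    by apply: filterS canonical_pair_sum => x /= [->].
  have W_nonneg : {ae P', forall x, forall w, nonneg_reals (W w x)}.
    by apply: ae_forall_count => w; apply: nonneg_reals_ae; exact: W_iid.2.
  apply: filterS3 good (nonneg_weights_ae la) W_nonneg => x fx ax Wx.
  pose t j := `|a x j| * (`|complex.Re (W (j, false) x)| * `|complex.Re (W (j, true) x)|).
  rewrite (_ : (fun n => _) = fun n => (\sum_(0 <= j < n) t j)%:C); last first.
    apply/funext => n; rewrite rmorph_sum; apply: eq_bigr => j _ /=.
    rewrite /t (ger0_norm (ax j)) !rmorphM /= mulrA.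
    by rewrite -(nonneg_reals_modulus (Wx (j, false))) -(nonneg_reals_modulus (Wx (j, true))).
  apply: cvg_real_complex.
  rewrite (_ : (fun n => _) = fun n => fine (\sum_(0 <= j < n) (t j)%:E)%E); last first.
    by apply/funext => n; rewrite sumEFin.
  apply: fine_cvg; rewrite fineK//.
  apply: is_cvg_nneseries => j _ _; by rewrite lee_fin !mulr_ge0.
- move=> B mB.
  have mC : measurable ((fun p => (fine (pair_sum p))%:C : R[i]) @^-1` B).
    rewrite -[X in measurable X]setTI.
    have : measurable_fun setT (real_complex R \o (@fine R \o pair_sum)).
      apply: measurableT_comp; first exact: measurable_real_complex.
      by apply: measurableT_comp => //; exact: measurable_pair_sum.
    exact.
  transitivity (P (pair_sample (X [::]) Z_child @^-1`
      ((fun p => (fine (pair_sum p))%:C : R[i]) @^-1` B))); first exact: law.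
  rewrite -(Zcomplex_law X_iid [::] mB).
  apply: (@ae_eq_preimage _ _ _ P _ _
    (fun x => (fine (pair_sum (pair_sample (X [::]) Z_child x)))%:C) (Zcomplex X [::])) => //.
  + apply: measurableT_comp; first exact: measurable_real_complex.
    apply: measurableT_comp => //.
    by apply: measurableT_comp measurable_pair_sum _; exact: pair_sample_measurable.
  + by apply: filterS canonical_pair_sum => x [-> _].
Qed.

Lemma S2_maps_Zlaw : S2_maps a0 (Zlaw X) (Zlaw X).
Proof.
split; last by move=> d' Om' P' a W; exact: S2_sum_Zlaw.
exists d, Om, P, (X [::]), Z_child; exact: S2_family_canonical.
Qed.

Lemma integral_Zlaw (f : R[i] -> \bar R) : measurable_fun setT f -> (forall z, 0 <= f z)%E ->
  (\int[Zlaw X]_z f z = \int[P]_x f (Zcomplex X [::] x))%E.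
Proof. by move=> mf f0; rewrite (ge0_integral_distribution (Zcomplex X [::])). Qed.

Lemma measurable_Re : measurable_fun setT (@complex.Re R).
Proof. by move=> _ A mA; apply: sub_sigma_algebra; left; exists A. Qed.

Lemma measurable_Im : measurable_fun setT (@complex.Im R).
Proof. by move=> _ A mA; apply: sub_sigma_algebra; right; exists A. Qed.

Lemma ae_Zlaw_nonneg_reals : {ae Zlaw X, forall z, nonneg_reals z}.
Proof.
by apply: ae_of_probability1; [exact: measurable_nonneg_reals|exact: Zlaw_nonneg_reals].
Qed.

Lemma Zlaw_second_moment : (\int[Zlaw X]_z ((Normc.normc z) ^+ 2)%:E = alpha%:E)%E.
Proof.
have normcE (z : R[i]) : Normc.normc z ^+ 2 = complex.Re z ^+ 2 + complex.Im z ^+ 2.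
  by case: z => x y /=; rewrite sqr_sqrtr// addr_ge0// sqr_ge0.
under eq_integral do rewrite normcE.
rewrite integral_Zlaw; last by move=> z; rewrite lee_fin addr_ge0// sqr_ge0.
  rewrite -(Zlim_square X_iid a0_mean s2E o2E s2_ge0 alpha_ge1 alpha_fix alpha_small [::]).
  apply: ge0_ae_eq_integral => //.
  - apply/measurable_EFinP; rewrite (_ : (fun x => _) = fun x => Zreal X [::] x ^+ 2).
      exact: measurable_funX.
    by apply/funext => x /=; rewrite expr0n /= addr0.
  - by apply: emeasurable_funM; exact: Zlim_measurable.
  - by move=> x _; rewrite lee_fin addr_ge0// sqr_ge0.
  - by move=> x _; rewrite mule_ge0// Zlim_ge0.
  - apply: filterS (Z_fin [::]) => x Zx _ /=.
    by rewrite expr0n /= addr0 expr2 EFinM fineK.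
apply/measurable_EFinP; apply: measurable_funD; apply: measurable_funX.
  exact: measurable_Re.
exact: measurable_Im.
Qed.

Lemma Zlaw_mean : (\int[Zlaw X]_z (complex.Re z)%:E = 1)%E.
Proof.
transitivity (\int[Zlaw X]_z modulus z)%E.
  apply: ae_eq_integral => //.
  - by apply/measurable_EFinP; exact: measurable_Re.
  - exact: measurable_modulus.
  - by apply: filterS ae_Zlaw_nonneg_reals => z [_ z0] _; rewrite /modulus ger0_norm.
rewrite integral_Zlaw; last by move=> z; rewrite lee_fin.
  rewrite -(Zlim_mean X_iid a0_mean s2E o2E s2_ge0 alpha_ge1 alpha_fix alpha_small [::]).
  apply: ge0_ae_eq_integral => //.
  - by apply: measurableT_comp (@measurable_modulus R) _; exact: measurable_funPT.
  - exact: Zlim_measurable.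
  - by move=> x _; rewrite lee_fin.
  - by move=> x _; exact: Zlim_ge0.
  - by apply: filterS (Z_fin [::]) => x Zx _; exact: modulus_Zcomplex.
exact: measurable_modulus.
Qed.

Lemma Zlaw_Im : (\int[Zlaw X]_z (complex.Im z)%:E = 0)%E.
Proof.
rewrite -[RHS](integral0 (Zlaw X) setT); apply: ae_eq_integral => //.
- by apply/measurable_EFinP; exact: measurable_Im.
- by apply: filterS ae_Zlaw_nonneg_reals => z [-> _] _.
Qed.

Lemma T_maps_Zlaw : alpha < bpar a0 * qpar a0 -> T_maps a0 (Zlaw X) (Zlaw X).
Proof.
move=> small; split.
- exact: Zlaw_mean.
- exact: Zlaw_Im.
- by rewrite Zlaw_second_moment lte_fin.
- exists d, Om, P, X_spine, Z_off; exact: T_family_canonical.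
- by move=> d' Om' P' a W; exact: T_limit_Zlaw.
Qed.

End transfer.

(** * Parameters and reindexing *)

(** The second root of the quadratic, [c - alpha], is also a fixed point, so it is
    [alpha] or [beta] and in both cases at least [alpha]. *)
Lemma cross_fixed_points (R : realType) (c e alpha beta : R) :
  [set x | e / (c - x) = x] = [set alpha; beta] -> alpha <= beta -> 1 <= alpha ->
  alpha * (c - alpha) = e /\ 2 * alpha <= c.
Proof.
move=> fix_eq ab a1.
have a0 : alpha != 0 by rewrite gt_eqF// (lt_le_trans ltr01).
have fixa : e / (c - alpha) = alpha.
  have : [set alpha; beta] alpha by left.
  by rewrite -fix_eq.
have ca0 : c - alpha != 0.
  by apply: contraNneq a0 => ca; rewrite -fixa ca invr0 mulr0.
have prod : alpha * (c - alpha) = e by rewrite -[X in X * _]fixa divfK.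
split=> //.
have : [set alpha; beta] (c - alpha).
  by rewrite -fix_eq /= subKr -prod mulrC mulKf.
by case=> /= h; lra.
Qed.

Lemma moment_fixed_point (R : realType) (s o alpha : R) : s != 0 ->
  alpha * (s^-1 - alpha) = (s + o) / s - 1 -> s * alpha ^+ 2 + o = alpha.
Proof.
move=> s0 h; have -> : o = s * ((s + o) / s - 1) by field.
by rewrite -h; field.
Qed.

(** The index map lands in [D], where the family is controlled; the left inverse
    [h] transports the events of the product formula. *)
Lemma iid_reindex_on (R : realType) d (Om : measurableType d) (P : probability Om R)
    (I K : choiceType) d' (E : measurableType d') (D : set I)
    (X : I -> {RV P >-> E}) (L : set E -> \bar R) (g : K -> I) (h : I -> K) :
  cancel g h -> (forall k, D (g k)) -> iid_family D X L ->
  iid_family setT (fun k => X (g k)) L.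
Proof.
move=> gK gD [iX lX]; split; last by move=> k _; exact: lX.
move=> J B _ mB.
have := iX (g @` J)%fset (fun i => B (h i)).
rewrite big_imfset/=; last by move=> k l _ _ /(can_inj gK).
have -> : (\prod_(k <- J) P (X (g k) @^-1` B (h (g k))))%E =
    (\prod_(k <- J) P (X (g k) @^-1` B k))%E.
  by apply: eq_bigr => k _; rewrite gK.
move=> <-.
- congr (P _); apply/seteqP; split => x H i /=.
    by move=> /imfsetP[k /= kJ ->]; rewrite gK; exact: H.
  by move=> iJ; have := H (g i); rewrite /= gK; apply; exact: in_imfset.
- by move=> i /= /imfsetP[k _ ->]; exact: gD.
- by move=> i /imfsetP[k /= kJ ->]; rewrite gK; exact: mB.
Qed.

Section parameters.
Local Open Scope ereal_scope.
Context (R : realType) d0 (Om0 : measurableType d0) (P0 : probability Om0 R).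
Variable a0 : {RV P0 >-> Rseq R}.
Hypothesis a0_ge0 : forall y j, (0 <= a0 y j)%R.

Lemma sum_seq_total y : sum_seq (a0 y) = total (a0 y).
Proof. by apply: eq_eseriesr => j _; rewrite /weight ger0_norm. Qed.

Lemma diag_momentE : diag_moment a0 = \int[P0]_y sum_sq (a0 y).
Proof.
have mw := measurable_weight_RV a0.
rewrite (eq_integral (fun y => \sum_(0 <= j <oo) (weight (a0 y) j * weight (a0 y) j))).
  rewrite integral_nneseries//.
    by move=> j; exact: emeasurable_funM.
  by move=> j y _; rewrite mule_ge0// weight_ge0.
move=> y _; apply: eq_eseriesr => j _.
by rewrite /weight ger0_norm// expr2 EFinM.
Qed.

End parameters.

Section zipped_index.
Context (R : realType) d (Om : measurableType d) (P : probability Om R).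
Variable a : seq nat * seq bool -> {RV P >-> Rseq R}.
Hypothesis a_ge0 : forall wm x j, same_length wm -> 0 <= a wm x j.

Definition zipped (t : word) : {RV P >-> Rseq R} := a (unzip1 t, unzip2 t).

Lemma zipped_iid (L : set (Rseq R) -> \bar R) :
  iid_family same_length a L -> iid_family setT zipped L.
Proof.
apply: (@iid_reindex_on _ _ _ _ _ _ _ _ _ _ _ (fun t => (unzip1 t, unzip2 t))
  (fun wm => zip wm.1 wm.2)).
  by move=> t /=; rewrite zip_unzip.
by move=> t; rewrite /same_length /= !size_map.
Qed.

Lemma Zrec_zip n w m x : size w = size m -> Zrec a n w m x = Zr zipped n (zip w m) x.
Proof.
elim: n w m => [//|n IH] w m wm /=; apply: eq_eseriesr => j _.
rewrite !IH ?size_rcons ?wm// !zip_rcons//; congr (_ * _ * _)%E.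
rewrite /weight /random_path /zipped unzip1_zip ?wm// unzip2_zip ?wm//.
by rewrite ger0_norm// a_ge0.
Qed.

Lemma Gn_zip n : Gn a n = family_sigma_algebra [set t : word | (size t < n)%N] zipped.
Proof.
rewrite /Gn /family_sigma_algebra; congr (<<s _ >>).
apply/seteqP; split => A.
  move=> [[w m] [/= wm wn] Aw]; rewrite /same_length /= in wm.
  exists (zip w m); first by rewrite /= size_zip wm minnn -wm.
  by rewrite /zipped unzip1_zip ?wm// unzip2_zip ?wm.
move=> [t /= tn At]; exists (unzip1 t, unzip2 t) => //.
by split; rewrite /same_length /= !size_map.
Qed.

End zipped_index.

Local Open Scope complex_scope.

Theorem theorem1 (R : realType)
  (d0 : measure_display) (Om0 : measurableType d0) (P0 : probability Om0 R)
  (a0 : {RV P0 >-> Rseq R})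
  (a0_ge0 : forall x j, 0 <= a0 x j)
  (a0_mean : (\int[P0]_x sum_seq (a0 x) = 1)%E)
  (a0_sq : (\int[P0]_x (sum_seq (a0 x) ^+ 2) < +oo)%E)
  (a0_not01 : ~ {ae P0, forall x, forall j, a0 x j = 0 \/ a0 x j = 1})
  (b_gt2 : 2 < bpar a0)
  (d : measure_display) (Om : measurableType d) (P : probability Om R)
  (a : seq nat * seq bool -> {RV P >-> Rseq R})
  (a_ge0 : forall wm x j, same_length wm -> 0 <= a wm x j)
  (a_iid : iid_family same_length a (distribution P0 a0))
  (alpha beta : R)
  (fixed_points : [set x | phi a0 x = x] = [set alpha; beta])
  (alpha_le_beta : alpha <= beta)
  (alpha_ge1 : 1 <= alpha) :
  [/\ martingale P (fun n => Gn a n.+1) (fun n => Zn a n.+1),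
      exists C : R, forall n, (0 < n)%N -> (\int[P]_x (Zn a n x ^+ 2) <= C%:E)%E &
      exists Z : {RV P >-> R},
        let M : probability R[i] R := distribution P (real_complex R \o Z) in
        [/\ {ae P, forall x, Zn a n x @[n --> \oo] --> (Z x)%:E},
            (\int[P]_x (`|Zn a n x - (Z x)%:E| ^+ 2))%E @[n --> \oo] --> 0%E,
            ('E_P[fun x => (Z x ^+ 2)%R] = alpha%:E)%E,
            S2_maps a0 M M /\ T_maps a0 M M &
            (\int[M]_z ((Normc.normc z) ^+ 2)%:E = alpha%:E)%E]].
Proof.
pose X := zipped a.
have X_iid : iid_family setT X (distribution P0 a0) by exact: zipped_iid.
have totalE y : sum_seq (a0 y) = total (a0 y) by exact: sum_seq_total.
have mean1 : (\int[P0]_y total (a0 y) = 1)%E.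
  by rewrite -a0_mean; apply: eq_integral => y _; rewrite totalE.
have sqE : (\int[P0]_y (sum_seq (a0 y) ^+ 2) = diag_moment a0 + offdiag_moment a0)%E.
  rewrite -(total_second_moment X_iid); apply: eq_integral => y _.
  by rewrite totalE expe2.
have off_ge0 : (0 <= offdiag_moment a0)%E.
  apply: nneseries_ge0 => i _ _; apply: nneseries_ge0 => j _ _.
  by case: ifP => // _; exact: moment_ge0.
have diag_ge0 := diag_moment_ge0 a0.
have diag_fin : diag_moment a0 \is a fin_num.
  by rewrite ge0_fin_numE// (le_lt_trans _ a0_sq)// sqE leeDl.
have off_fin : offdiag_moment a0 \is a fin_num.
  by rewrite ge0_fin_numE// (le_lt_trans _ a0_sq)// sqE leeDr.
pose s2 := fine (diag_moment a0); pose o2 := fine (offdiag_moment a0).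
have s2E : diag_moment a0 = s2%:E by rewrite /s2 fineK.
have o2E : offdiag_moment a0 = o2%:E by rewrite /o2 fineK.
have s2_ge0 : 0 <= s2 by exact: fine_ge0.
have bE : bpar a0 = (s2 + o2) / s2.
  by rewrite /bpar sqE -diag_momentE// s2E o2E.
have qE : qpar a0 = (s2 + o2)^-1 by rewrite /qpar sqE s2E o2E.
have s2_neq0 : s2 != 0.
  by apply: contraTneq b_gt2 => s0; rewrite bE s0 invr0 mulr0 -leNgt.
have m2_neq0 : s2 + o2 != 0.
  by apply: contraTneq b_gt2 => s0; rewrite bE s0 mul0r -leNgt.
have bqE : bpar a0 * qpar a0 = s2^-1.
  by rewrite bE qE mulrAC divff// mul1r.
have [alpha_prod alpha_half] := cross_fixed_points fixed_points alpha_le_beta alpha_ge1.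
rewrite bqE in alpha_prod alpha_half.
have alpha_fix : s2 * alpha ^+ 2 + o2 = alpha.
  by apply: moment_fixed_point => //; rewrite alpha_prod bE.
have alpha_small : 2 * s2 * alpha <= 1.
  have := ler_wpM2l s2_ge0 alpha_half; rewrite divff//.
  by rewrite mulrA (mulrC s2).
have alpha_lt : alpha < bpar a0 * qpar a0.
  by rewrite bqE (lt_le_trans _ alpha_half)// mulr_natl mulr2n ltrDl (lt_le_trans ltr01).
pose sm := second_moment s2 o2.
have ZnE n x : Zn a n x = Zr X n [::] x by exact: Zrec_zip.
have ZnE' n : Zn a n = Zr X n [::] by apply/funext => x; exact: ZnE.
have sqZ n : (\int[P]_x (Zn a n x ^+ 2) = (sm n)%:E)%E.
  rewrite -(Zr_square X_iid mean1 s2E o2E n [::]).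
  by apply: eq_integral => x _; rewrite ZnE expe2.
have sm_le n : sm n <= alpha by exact: second_moment_le_alpha.
have sm_cvg : sm @ \oo --> alpha by exact: second_moment_cvg.
have meanZ n : (\int[P]_x Zn a n x = 1)%E by rewrite ZnE'; exact: (Zr_mean X_iid).
have mZ n : measurable_fun setT (Zn a n) by rewrite ZnE'; exact: Zr_measurable.
have Z_ge0 n x : (0 <= Zn a n x)%E by rewrite ZnE; exact: Zr_ge0.
split.
- split.
  + move=> n; rewrite Gn_zip; split; first exact: smallest_sigma_algebra.
    exact: family_sigma_measurable.
  + move=> n; rewrite !Gn_zip; apply: family_sigma_sub => t /= tn.
    exact: (ltn_trans tn).
  + move=> n; rewrite Gn_zip ZnE'; apply: depends_on_preimage.
    by apply: depends_on_sub (@Zr_depends _ _ _ _ X n.+1 [::]) => t [_].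
  + move=> n; apply/integrableP; split; first exact: mZ.
    by under eq_integral do rewrite gee0_abs//; rewrite meanZ ltry.
  + move=> n A; rewrite Gn_zip => nA.
    rewrite -[LHS]integral_indicM -[RHS]integral_indicM !ZnE'.
    apply: (martingale_step X_iid mean1).
      apply: depends_on_sub (depends_on_indic nA) => t /= tn [_].
      by rewrite add0n leqNgt tn.
    by move=> x; rewrite lee_fin.
- by exists alpha => n _; rewrite sqZ lee_fin.
- exists (Zreal X [::]) => M.
  have Zfin := Zlim_fin X_iid mean1 s2E o2E s2_ge0 alpha_ge1 alpha_fix alpha_small [::].
  have [sqlim _ distlim] :=
    Zlim_moments X_iid mean1 s2E o2E s2_ge0 alpha_ge1 alpha_fix alpha_small [::].
  have MZ : M = Zlaw X by [].
  split.
  + apply: filterS (Zlim_cvg X_iid mean1 s2E o2E s2_ge0 alpha_ge1 alpha_fix alpha_small [::]).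
    by move=> x [Zx]; rewrite /= fineK// (funext (fun n => ZnE n x)).
  + rewrite (_ : (fun n => _) = fun n => (alpha - sm n)%:E).
      rewrite -[X in _ --> X]/(0%R)%:E -(subrr alpha); apply: cvg_EFin; first exact: nearW.
      by apply: cvgB => //; exact: cvg_cst.
    apply/funext => n; rewrite -distlim; apply: ge0_ae_eq_integral => //.
    * apply: (@measurable_sqdist _ _ _ (Zn a n) (fun x => (Zreal X [::] x)%:E)) => //.
      by apply/measurable_EFinP; exact: measurable_funPT.
    * by apply: measurable_sqdist; [exact: Zlim_measurable|exact: Zr_measurable].
    * by move=> x _; exact: sqre_ge0.
    * by move=> x _; exact: sqdist_ge0.
    * have Zn_fin : {ae P, forall x, Zn a n x \is a fin_num}.
        by apply: ge0_ae_fin => //; rewrite meanZ ltry.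
      apply: filterS2 Zfin Zn_fin => x Zx Znx _.
      have -> : (Zreal X [::] x)%:E = Zlim X [::] x by exact: fineK.
      rewrite /sqdist -ZnE.
      by rewrite -(fineK Zx) -(fineK Znx) -!EFinB !abse_EFin distrC.
  + rewrite unlock -sqlim; apply: ge0_ae_eq_integral => //.
    * by apply/measurable_EFinP; exact: measurable_funX.
    * by apply: emeasurable_funM; exact: Zlim_measurable.
    * by move=> x _; rewrite lee_fin sqr_ge0.
    * by move=> x _; rewrite mule_ge0// Zlim_ge0.
    * by apply: filterS Zfin => x Zx _; rewrite /= expr2 EFinM fineK.
  + rewrite MZ; split.
      exact: (S2_maps_Zlaw X_iid a0_ge0 mean1 s2E o2E s2_ge0
      alpha_ge1 alpha_fix alpha_small).
    exact: (T_maps_Zlaw X_iid a0_ge0 mean1 s2E o2E s2_ge0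
      alpha_ge1 alpha_fix alpha_small).
  + rewrite MZ.
    exact: (Zlaw_second_moment X_iid mean1 s2E o2E s2_ge0
      alpha_ge1 alpha_fix alpha_small).
Qed.
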